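(* Consider the solution $f:\Gamma_{accr}\to\mathbb{R}$ of the Liouville equation on the Schwarzschild background given by $$ f(x,p)=\begin{cases}{\cal F}_i^{(abs)}\big(G_{\varepsilon,\lambda}(\xi,\pi_\xi)-\tau,Q^2,Q^3,\varepsilon,\lambda_z,\lambda\big), & \lambda<\lambda_c(\varepsilon),\\ {\cal F}_i^{(scat)}\big(G_{\varepsilon,\lambda}(\xi,\pi_\xi)-\tau,Q^2,Q^3,\varepsilon,\lambda_z,\lambda\big), & \lambda>\lambda_c(\varepsilon),\end{cases} $$ whose initial data ${\cal F}_i^{(abs)}:R^{(abs)}\to\mathbb{R}$, ${\cal F}_i^{(scat)}:R^{(scat)}\to\mathbb{R}$ satisfy: (i) they are non-negative, measurable, $2\pi$-periodic in $Q^2$ and $Q^3$, and there exist constants $\alpha,\beta>0$ with $0\le {\cal F}_i^{(abs,scat)}(G,Q^2,Q^3,\varepsilon,\lambda_z,\lambda)\le \alpha e^{-\beta\varepsilon}$ on $R^{(abs,scat)}$; (ii) there is a function $f_{-\infty}:(1,\infty)\to\mathbb{R}$ such that $\lim_{G\to-\infty}{\cal F}_i^{(abs)}(G,Q^2,Q^3,\varepsilon,\lambda_z,\lambda)=f_{-\infty}(\varepsilon)$ for all $Q^2,Q^3\in[0,2\pi]$, $\varepsilon>1$, $|\lambda_z|<\lambda<\lambda_c(\varepsilon)$; (iii) there is a function $f_{+\infty}:(1,\infty)\to\mathbb{R}$ such that, for every $\varepsilon>1$, ${\cal F}_i^{(scat)}(G,\cdot)\to f_{\pm\infty}(\varepsilon)$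 as $G\to\pm\infty$, uniformly in $Q^2,Q^3\in[0,2\pi]$ and $|\lambda_z|<\lambda$, $\lambda>\lambda_c(\varepsilon)$. Then, along the world line $\gamma(t)$ of any future-directed static observer (fixed $\xi>2$, $\vartheta$, $\varphi$), $$ \lim_{t\to\infty}J_\alpha(\gamma(t))=J_\alpha[f_{-\infty}],\qquad \lim_{t\to\infty}T_{\alpha\beta}(\gamma(t))=T_{\alpha\beta}[f_{-\infty}], $$ where $J_\alpha$, $T_{\alpha\beta}$ are the components, with respect to the non-rotating static frame $e_0=\frac{M_H}{\sqrt{1-2/\xi}}\partial_\tau$, $e_1=\frac{M_H}{\sqrt{1-2/\xi}}\big[\frac{2}{\xi}\partial_\tau+(1-\frac{2}{\xi})\partial_\xi\big]$, $e_2=\frac{M_H}{\xi}\partial_\vartheta$, $e_3=\frac{M_H}{\xi\sin\vartheta}\partial_\varphi$, of the particle current density $J_\mu(x)=\int_{\pi^{-1}(x)}p_\mu f\,\mathrm{dvol}_x(p)$ and stress energy-momentum tensor $T_{\mu\nu}(x)=\int_{\pi^{-1}(x)}p_\mu p_\nu f\,\mathrm{dvol}_x(p)$ of $f$ (restricted to $\Gamma_{accr}$), and $J_\alpha[f_{-\infty}]$, $T_{\alpha\beta}[f_{-\infty}]$ are the corresponding frame components of the current density and stress energy-momentum tensor (sum of the absorbed- and scattered-particle contributions) of the steady-state, spherically symmetric distribution function $f(x,p)=\delta(P_0(x,p)-m)\,f_{-\infty}(P_1(x,p)/m)$ on $\Gamma_{accr}$.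
   Context: Setting: Schwarzschild black hole of mass $M_H>0$ in horizon-penetrating coordinates $(t,r,\vartheta,\varphi)$ with metric $g=-N dt^2+2(1-N)dt\,dr+(2-N)dr^2+r^2(d\vartheta^2+\sin^2\vartheta d\varphi^2)$, $N=1-2M_H/r$; dimensionless $\tau=t/M_H$, $\xi=r/M_H$. Kinetic gas of collisionless particles all of rest mass $m>0$, distribution function on the cotangent bundle solving $L[f]=0$ (Liouville equation), restricted to $\Gamma_{accr}$, the part of the future mass shell consisting of unbounded trajectories coming from infinity that are either absorbed by the black hole or scattered back to infinity. Conserved quantities: $P_0=\sqrt{-g^{\mu\nu}p_\mu p_\nu}$ (mass), $P_1=E=-p_t$, $\ell_z=p_\varphi$, $\ell=\sqrt{p_\vartheta^2+p_\varphi^2/\sin^2\vartheta}$; dimensionless $\varepsilon=E/m$, $\lambda=\ell/(M_Hm)$, $\lambda_z=\ell_z/(M_Hm)$, $\pi_\xi=p_r/m$. Effective potential $U_\lambda(\xi)=(1-2/\xi)(1+\lambda^2/\xi^2)$; $\lambda_c(\varepsilon)$ is the angular momentum for which the maximum of $U_\lambda$ equals $\varepsilon^2$ (absorbed: $\lambda<\lambda_c$; scattered: $\lambda>\lambda_c$). $G_{\varepsilon,\lambda}(\xi,\pi_\xi)=\int_{\gamma}\frac{\frac{2}{\xi}\pi_\xi+(1+\frac{2}{\xi})\varepsilon}{(1-\frac{2}{\xi})\pi_\xi-\frac{2}{\xi}\varepsilon}d\xi$ is the line integral along the invariant curve $(1-\frac2\xi)\pi_\xi^2-\frac4\xi\varepsilon\pi_\xi-(1+\frac2\xi)\varepsilon^2+1+\frac{\lambda^2}{\xi^2}=0$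 from a reference point (the horizon $\xi=2$ for absorbed particles, the turning point for scattered ones); $Q^2,Q^3$ are the angle variables conjugate to $\ell_z,\ell$. Ranges: $R^{(abs)}=\{G\le0,\ \varepsilon>1,\ |\lambda_z|<\lambda,\ 0\le\lambda<\lambda_c(\varepsilon)\}$, $R^{(scat)}=\{G\in\mathbb{R},\ \varepsilon>1,\ |\lambda_z|<\lambda,\ \lambda>\lambda_c(\varepsilon)\}$ (with $Q^2,Q^3$ real). The fibre volume element is $\mathrm{dvol}_x(p)=\sqrt{-\det(g^{\mu\nu})}\,d^4p$. *)

(* Defs.v *)
From mathcomp Require Import all_boot all_order all_algebra.
From mathcomp Require Import all_classical all_reals all_analysis.
Set Implicit Arguments. Unset Strict Implicit. Unset Printing Implicit Defensive.
Import Order.TTheory GRing.Theory Num.Theory numFieldNormedType.Exports.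
Local Open Scope classical_set_scope.
Local Open Scope ring_scope.

Section Schwarzschild.
Variable R : realType.

Definition Ueff (lam xi : R) : R := (1 - 2 / xi) * (1 + lam ^+ 2 / xi ^+ 2).

Definition Umax (lam : R) : R := sup [set Ueff lam x | x in `]2, +oo[%classic].

Definition lambda_c (eps : R) : R :=
  xget 0 [set l : R | 0 <= l /\ Umax l = eps ^+ 2].

(* outermost turning point: largest xi > 2 with U_lambda(xi) = eps^2
   (sup of the classically forbidden region {xi > 2 | U_lambda(xi) >= eps^2}) *)
Definition turning (eps lam : R) : R :=
  sup [set x : R | 2 < x /\ eps ^+ 2 <= Ueff lam x].

(* the branch sigma = +1 (outgoing) / -1 (ingoing) of the invariant curve
   (1-2/xi)pi^2 - 4/xi eps pi - (1+2/xi) eps^2 + 1 + lam^2/xi^2 = 0 *)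
Definition pi_branch (eps lam sigma s : R) : R :=
  (2 * eps / s + sigma * Num.sqrt (eps ^+ 2 - Ueff lam s)) / (1 - 2 / s).

Definition hG (eps s pi : R) : R :=
  ((2 / s) * pi + (1 + 2 / s) * eps) / ((1 - 2 / s) * pi - (2 / s) * eps).

Definition Gline (eps lam sigma xiref xi : R) : R :=
  \int[lebesgue_measure]_(s in `]xiref, xi[%classic)
     hG eps s (pi_branch eps lam sigma s).

(* the precession integral entering the angle variable Q^3 (d chi / d xi
   integrated along the same branch from the same reference point) *)
Definition Chiline (eps lam sigma xiref xi : R) : R :=
  \int[lebesgue_measure]_(s in `]xiref, xi[%classic)
     (lam / (s ^+ 2 * (sigma * Num.sqrt (eps ^+ 2 - Ueff lam s)))).

Variables (MH m : R).
(* a point x = (t, r, th, ph); a covector p = (p_t, p_r, p_th, p_ph) on the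
   future mass shell is parametrized by (p_r, p_th, p_ph), p_t being the
   future-directed solution of g^{mu nu} p_mu p_nu = - m^2, where
   g^{tt} = -(1+2MH/r), g^{tr} = 2MH/r, g^{rr} = 1-2MH/r,
   g^{th th} = 1/r^2, g^{ph ph} = 1/(r^2 sin^2 th). *)
Definition ell2 (th pth pph : R) : R := pth ^+ 2 + pph ^+ 2 / (sin th) ^+ 2.

Definition p_up_t (r th pr pth pph : R) : R :=
  Num.sqrt (pr ^+ 2 + (1 + 2 * MH / r) * (ell2 th pth pph / r ^+ 2 + m ^+ 2)).

Definition p_t (r th pr pth pph : R) : R :=
  ((2 * MH / r) * pr - p_up_t r th pr pth pph) / (1 + 2 * MH / r).

(* contravariant radial component p^r = g^{rt} p_t + g^{rr} p_r *)
Definition p_up_r (r th pr pth pph : R) : R :=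
  (2 * MH / r) * p_t r th pr pth pph + (1 - 2 * MH / r) * pr.

Definition epsP (r th pr pth pph : R) : R := - p_t r th pr pth pph / m.
Definition lamP (th pth pph : R) : R := Num.sqrt (ell2 th pth pph) / (MH * m).
Definition lamzP (pph : R) : R := pph / (MH * m).
Definition sigP (r th pr pth pph : R) : R :=
  if 0 <= p_up_r r th pr pth pph then 1 else -1.

Definition angle2 (a b : R) : R :=
  if 0 <= b then acos (a / Num.sqrt (a ^+ 2 + b ^+ 2))
  else 2 * pi - acos (a / Num.sqrt (a ^+ 2 + b ^+ 2)).

Definition Lx (th ph pth pph : R) : R := - sin ph * pth - cos th / sin th * cos ph * pph.
Definition Ly (th ph pth pph : R) : R := cos ph * pth - cos th / sin th * sin ph * pph.
Definition Lz (pph : R) : R := pph.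

(* Q^2 : longitude of the ascending node, i.e. polar angle of z x L = (-Ly, Lx, 0);
   it is the angle variable conjugate to ell_z *)
Definition Q2 (th ph pth pph : R) : R := angle2 (- Ly th ph pth pph) (Lx th ph pth pph).

(* argument of latitude: angle in the orbital plane from the node vector
   n = (-Ly, Lx, 0) to the position unit vector, oriented by L *)
Definition arg_lat (th ph pth pph : R) : R :=
  let n1 := - Ly th ph pth pph in let n2 := Lx th ph pth pph in
  let L1 := Lx th ph pth pph in let L2 := Ly th ph pth pph in let L3 := Lz pph in
  let x1 := sin th * cos ph in let x2 := sin th * sin ph in let x3 := cos th in
  (* L x n *)
  let c1 := - L3 * n2 in let c2 := L3 * n1 in let c3 := L1 * n2 - L2 * n1 in
  angle2 (x1 * n1 + x2 * n2)
         ((x1 * c1 + x2 * c2 + x3 * c3) / Num.sqrt (ell2 th pth pph)).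

Definition absorbed (r th pr pth pph : R) : Prop :=
  1 < epsP r th pr pth pph /\
  lamP th pth pph < lambda_c (epsP r th pr pth pph) /\
  p_up_r r th pr pth pph < 0.

Definition scattered (r th pr pth pph : R) : Prop :=
  1 < epsP r th pr pth pph /\
  lambda_c (epsP r th pr pth pph) < lamP th pth pph /\
  turning (epsP r th pr pth pph) (lamP th pth pph) < r / MH.

Definition xiref (r th pr pth pph : R) : R :=
  if `[< absorbed r th pr pth pph >] then 2
  else turning (epsP r th pr pth pph) (lamP th pth pph).

Definition Gp (r th pr pth pph : R) : R :=
  Gline (epsP r th pr pth pph) (lamP th pth pph) (sigP r th pr pth pph)
        (xiref r th pr pth pph) (r / MH).

Definition Q3 (r th ph pr pth pph : R) : R :=
  arg_lat th ph pth pph -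
  Chiline (epsP r th pr pth pph) (lamP th pth pph) (sigP r th pr pth pph)
          (xiref r th pr pth pph) (r / MH).

Definition f_accr (Fabs Fscat : R -> R -> R -> R -> R -> R -> R)
    (t r th ph pr pth pph : R) : R :=
  let args F := F (Gp r th pr pth pph - t / MH) (Q2 th ph pth pph)
                  (Q3 r th ph pr pth pph) (epsP r th pr pth pph)
                  (lamzP pph) (lamP th pth pph) in
  if `[< absorbed r th pr pth pph >] then args Fabs
  else if `[< scattered r th pr pth pph >] then args Fscat else 0.

(* steady-state distribution f_{-oo}(P_1/m) on Gamma_accr (the factor
   delta(P_0 - m) is carried by the fibre measure below) *)
Definition f_steady (fm : R -> R) (t r th ph pr pth pph : R) : R :=
  if `[< absorbed r th pr pth pph \/ scattered r th pr pth pph >]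
  then fm (epsP r th pr pth pph) else 0.

(* dvol_x(p) = sqrt(-det g^{mu nu}) d^4p = d^4p / (r^2 sin th); integrating
   out delta(P_0 - m) in p_t over the future sheet gives the factor
   m / p^t, hence the density below w.r.t. d p_r d p_th d p_ph. *)
Definition shell_weight (r th pr pth pph : R) : R :=
  m / (r ^+ 2 * sin th * p_up_t r th pr pth pph).

(* frame components e_a(p) = e_a^mu p_mu of the covector p, for the
   orthonormal non-rotating static frame
   e_0 = (1-2M/r)^{-1/2} d_t,
   e_1 = (1-2M/r)^{-1/2} [ (2M/r) d_t + (1-2M/r) d_r ],
   e_2 = r^{-1} d_th,  e_3 = (r sin th)^{-1} d_ph. *)
Definition pframe (a : nat) (r th pr pth pph : R) : R :=
  let N := 1 - 2 * MH / r in
  match a with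
  | 0%N => p_t r th pr pth pph / Num.sqrt N
  | 1%N => ((2 * MH / r) * p_t r th pr pth pph + N * pr) / Num.sqrt N
  | 2%N => pth / r
  | _ => pph / (r * sin th)
  end.

Definition mom3 := ((@lebesgue_measure R) \x (@lebesgue_measure R)
                      \x (@lebesgue_measure R))%E.

Definition Jframe (f : R -> R -> R -> R -> R -> R -> R -> R) (a : nat)
    (t r th ph : R) : R :=
  \int[mom3]_(q in setT)
     (pframe a r th q.1.1 q.1.2 q.2 * f t r th ph q.1.1 q.1.2 q.2
      * shell_weight r th q.1.1 q.1.2 q.2).

Definition Tframe (f : R -> R -> R -> R -> R -> R -> R -> R) (a b : nat)
    (t r th ph : R) : R :=
  \int[mom3]_(q in setT)
     (pframe a r th q.1.1 q.1.2 q.2 * pframe b r th q.1.1 q.1.2 q.2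
      * f t r th ph q.1.1 q.1.2 q.2 * shell_weight r th q.1.1 q.1.2 q.2).

End Schwarzschild.

Definition R_abs {R : realType} (y : R * R * R * R * R * R) : Prop :=
  let: (G, q2, q3, eps, lz, lam) := y in
  G <= 0 /\ 1 < eps /\ `|lz| < lam /\ 0 <= lam /\ lam < lambda_c eps.

Definition R_scat {R : realType} (y : R * R * R * R * R * R) : Prop :=
  let: (G, q2, q3, eps, lz, lam) := y in
  1 < eps /\ `|lz| < lam /\ lambda_c eps < lam.

Definition uncurry6 {R : Type} (F : R -> R -> R -> R -> R -> R -> R)
  (y : R * R * R * R * R * R) : R :=
  let: (a, b, c, d, e, g) := y in F a b c d e g.

(* Main.v *)
From HB Require Import structures.
Require Import Defs.
From mathcomp Require Import all_boot all_order all_algebra.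
From mathcomp Require Import all_classical all_reals all_analysis.
From mathcomp Require Import measurable_realfun.
From mathcomp Require Import ring lra.
Import Order.TTheory GRing.Theory Num.Theory numFieldNormedType.Exports.
Local Open Scope classical_set_scope.
Local Open Scope ring_scope.
Set Implicit Arguments.
Unset Strict Implicit.
Unset Printing Implicit Defensive.

(** For a fixed momentum only the first argument G - t / MH of the data depends on
    t, and it tends to -oo, so f tends pointwise to f_{-oo}(eps) on Gamma_accr; the
    angle Q^3 is first moved to [0, 2 pi] by periodicity. Since
    eps >= kappa p^t with kappa > 0 at a static observer, the bound
    alpha exp(- beta eps) dominates the integrands by an integrable exponential,
    and dominated convergence concludes. Measurability of f in the momentum is
    the delicate point. For eps > 1 the condition lambda < lambda_c(eps) reads
    sup U_lambda < eps^2, with sup U_lambda continuous in lambda, and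
    s > turning(eps, lambda) says that a cubic, convex for s > 0, is positive with
    positive slope at s; the orbit integrals are then parametric integrals of
    jointly measurable functions. *)

(** * Measurability and integration *)

Section MeasurableReal.
Context {R : realType}.

Lemma measurable_invr : measurable_fun [set: R] (@GRing.inv R).
Proof.
rewrite -(setUv [set 0 : R]); apply/measurable_funU => //; first exact: measurableC.
split; first exact: measurable_fun_set1.
apply: open_continuous_measurable_fun.
  apply: closed_openC; apply: accessible_closed_set1; exact/hausdorff_accessible/Rhausdorff.
by move=> x /set_mem/= /eqP; exact: inv_continuous.
Qed.

Lemma measurable_sqrtr : measurable_fun [set: R] (@Num.sqrt R).
Proof. by apply: continuous_measurable_fun; exact: sqrt_continuous. Qed.

Lemma measurable_acos : measurable_fun (`[-1, 1]%classic : set R) (@acos R).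
Proof.
(* The endpoints do not affect measurability, so continuity on the open interval is enough. *)
apply: (@measurable_fun_itv_cc _ _ _ false true).
apply: open_continuous_measurable_fun; first exact: itv_open.
by move=> x /set_mem/=; rewrite in_itv/=; exact: continuous_acos.
Qed.

Context {d} {T : measurableType d}.

Lemma measurable_funV (D : set T) (f : T -> R) :
  measurable_fun D f -> measurable_fun D (fun x => (f x)^-1).
Proof. exact: measurableT_comp measurable_invr. Qed.

Lemma measurable_funsqrt (D : set T) (f : T -> R) :
  measurable_fun D f -> measurable_fun D (fun x => Num.sqrt (f x)).
Proof. exact: measurableT_comp measurable_sqrtr. Qed.

Lemma measurable_fun_acos (D : set T) (f : T -> R) : measurable D ->
  (forall x, D x -> -1 <= f x <= 1) ->
  measurable_fun D f -> measurable_fun D (fun x => acos (f x)).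
Proof.
move=> mD fD mf; apply: (measurable_comp _ _ measurable_acos) => //.
by move=> _ /= [x Dx <-]; rewrite in_itv/=; exact: fD.
Qed.

Lemma measurable_predset (P : pred T) :
  measurable_fun setT P -> measurable [set x | P x].
Proof.
move=> mP; rewrite -[X in measurable X]setTI.
have := mP measurableT [set true] I.
by congr measurable; apply/seteqP; split=> x /=.
Qed.

End MeasurableReal.

(** * Integrals: null sets, parameters, limits and products *)

Section IntegralFacts.
Local Open Scope ereal_scope.
Context d (T : measurableType d) (R : realType).
Variable mu : {measure set T -> \bar R}.
Import HBNNSimple.

(** Here [f] may be non-measurable on [N], so the two integrals are compared through their
    definition as suprema over simple functions. *)
Lemma ge0_integral_setC_null (N : set T) (f : T -> \bar R) :
  measurable N -> mu N = 0 -> (forall x, 0 <= f x) ->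
  \int[mu]_x f x = \int[mu]_(x in ~` N) f x.
Proof.
move=> mN N0 f0; rewrite [RHS]integral_mkcond.
have f0' x : 0 <= (f \_ (~` N)) x by rewrite patchE; case: ifP.
rewrite !ge0_integralTE//; apply/eqP; rewrite eq_le; apply/andP; split.
  apply: ge_ereal_sup => _ [h hf <-].
  (* Cutting [h] off on the null set [N] keeps its integral and puts it below the restriction of
     [f]. *)
  pose k := mul_nnsfun h (indic_nnsfun R (measurableC mN)).
  apply: (@le_trans _ _ (sintegral mu k)).
    rewrite -!integralT_nnsfun (ge0_negligible_integral mN)//; last 2 first.
    - by apply/measurable_EFinP.
    - by move=> x _; rewrite lee_fin.
    rewrite [leRHS](ge0_negligible_integral mN)//; last 2 first.
    - by apply/measurable_EFinP.
    - by move=> x _; rewrite lee_fin.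
    rewrite le_eqVlt; apply/orP; left; apply/eqP; apply: eq_integral => x.
    rewrite setTD inE => Nx; congr EFin.
    by rewrite /k /= /mindic indicE mem_set// mulr1.
  apply: ereal_sup_ubound; exists k => // x.
  rewrite /k /= /mindic patchE indicE; case: ifPn => _; first by rewrite mulr1.
  by rewrite mulr0.
apply: ge_ereal_sup => _ [h hf <-]; apply: ereal_sup_ubound; exists h => // x.
by apply: le_trans (hf x) _; rewrite patchE; case: ifPn.
Qed.

Lemma integral_setC_null (N : set T) (f : T -> \bar R) :
  measurable N -> mu N = 0 -> \int[mu]_x f x = \int[mu]_(x in ~` N) f x.
Proof.
move=> mN N0; rewrite integralE [RHS]integralE.
by congr (_ - _); apply: ge0_integral_setC_null => // x; rewrite ?funepos_ge0 ?funeneg_ge0.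
Qed.

End IntegralFacts.

Lemma Rintegral_setC_null d (T : measurableType d) (R : realType)
  (mu : {measure set T -> \bar R}) (N : set T) (f : T -> R) :
  measurable N -> mu N = 0%E ->
  \int[mu]_x f x = \int[mu]_(x in ~` N) f x.
Proof. by move=> mN N0; rewrite /Rintegral (integral_setC_null _ mN N0). Qed.

(** The sections of [k] may fail to be integrable, so Tonelli is applied to the positive and
    negative parts separately; [fine] then assigns 0 to infinite values. *)
Lemma measurable_parametric_Rintegral d d' (X : measurableType d)
  (Y : measurableType d') (R : realType)
  (mu : {sigma_finite_measure set Y -> \bar R}) (k : X * Y -> R) :
  measurable_fun setT k -> measurable_fun setT (fun x => \int[mu]_y k (x, y)).
Proof.
move=> mk; rewrite /Rintegral.
apply: (measurableT_comp (@fine_measurable R setT measurableT)).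
under eq_fun do rewrite integralE.
have mk' : measurable_fun setT (EFin \o k) by exact/measurable_EFinP.
apply: emeasurable_funB.
- apply: eq_measurable_fun (measurable_fun_fubini_tonelli_F (m2 := mu)
    (EFin \o k)^\+%E (measurable_funepos mk') (@funepos_ge0 _ _ _)) => x _.
  by rewrite /fubini_F; apply: eq_integral => y _; rewrite !funeposE.
- apply: eq_measurable_fun (measurable_fun_fubini_tonelli_F (m2 := mu)
    (EFin \o k)^\-%E (measurable_funeneg mk') (@funeneg_ge0 _ _ _)) => x _.
  by rewrite /fubini_F; apply: eq_integral => y _; rewrite !funenegE.
Qed.

(** Dominated convergence is a statement on sequences; a limit at infinity is tested along every
    sequence [u] tending to infinity. *)
Lemma Rintegral_cvg_pinfty d (T : measurableType d) (R : realType)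
  (mu : {measure set T -> \bar R}) (D : set T) (f : R -> T -> R) (h g : T -> R) :
  measurable D ->
  (forall t, 0 <= t -> measurable_fun D (f t)) ->
  (forall x, D x -> f t x @[t --> +oo] --> h x) ->
  mu.-integrable D (EFin \o g) ->
  (forall t x, 0 <= t -> D x -> `|f t x| <= g x) ->
  \int[mu]_(x in D) f t x @[t --> +oo] --> \int[mu]_(x in D) h x.
Proof.
move=> mD mf fh ig fg.
have cvg0 (F : R -> R) l : F (Num.max t 0) @[t --> +oo] --> l -> F t @[t --> +oo] --> l.
  move=> H; apply: cvg_trans H; apply: near_eq_cvg.
  by near=> t; rewrite max_l//; near: t; exact: nbhs_pinfty_ge.
apply: cvg0; apply/cvg_pinftyP => u uy.
(* Measurability and domination are given for t >= 0 only; truncating [u n] at 0 enforces this for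
   all n and changes only finitely many terms. *)
pose f' n x := f (Num.max (u n) 0) x.
have u0 n : 0 <= Num.max (u n) 0 by rewrite le_max lexx orbT.
have mf' n : measurable_fun D (f' n) by exact: mf.
have f'h x : D x -> f' ^~ x @ \oo --> h x.
  move=> Dx; have /cvg_pinftyP/(_ u uy) := fh x Dx.
  apply: cvg_trans; apply: near_eq_cvg.
  by near=> n; rewrite /f' max_l//; near: n; move/cvgryPge: uy; exact.
have mh : measurable_fun D h by exact: (measurable_fun_cvg mf').
have ef'h : {ae mu, forall x, D x -> (f' n x)%:E @[n --> \oo] --> (h x)%:E}.
  by apply: aeW => x /f'h fx; apply: cvg_EFin => //; exact: nearW.
have ef'g : {ae mu, forall x n, D x -> (`|(f' n x)%:E| <= (g x)%:E)%E}.
  by apply: aeW => x n Dx; rewrite abse_EFin lee_fin fg.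
have emf' n : measurable_fun D (fun x => (f' n x)%:E) by exact/measurable_EFinP.
have emh : measurable_fun D (fun x => (h x)%:E) by exact/measurable_EFinP.
have [ih _ cvgf] := dominated_convergence mD emf' emh ef'h ig ef'g.
rewrite /Rintegral; apply: fine_cvg; rewrite fineK//.
exact: integrable_fin_num.
Unshelve. all: by end_near. Qed.

(** By Tonelli the double integral factors into two finite ones. *)
Lemma ge0_integrable_tensor d1 d2 (T1 : measurableType d1) (T2 : measurableType d2)
  (R : realType) (m1 : {sigma_finite_measure set T1 -> \bar R})
  (m2 : {sigma_finite_measure set T2 -> \bar R}) (f : T1 -> R) (g : T2 -> R) :
  (forall x, 0 <= f x) -> (forall y, 0 <= g y) ->
  m1.-integrable setT (EFin \o f) -> m2.-integrable setT (EFin \o g) ->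
  (m1 \x m2)%E.-integrable setT (fun z => (f z.1 * g z.2)%:E).
Proof.
move=> f0 g0 fi gi.
have mf := proj1 (measurable_EFinP _ _) (measurable_int _ fi).
have mg := proj1 (measurable_EFinP _ _) (measurable_int _ gi).
have mfg : measurable_fun setT (fun z : T1 * T2 => (f z.1 * g z.2)%:E).
  apply/measurable_EFinP; apply: measurable_funM.
  - by apply: measurableT_comp mf _; exact: measurable_fst.
  - by apply: measurableT_comp mg _; exact: measurable_snd.
apply/integrableP; split => //.
rewrite (eq_integral (fun z => (f z.1 * g z.2)%:E)); last first.
  by move=> z _; rewrite abse_EFin ger0_norm// mulr_ge0.
rewrite (fubini_tonelli1 (fun z : T1 * T2 => (f z.1 * g z.2)%:E))//; last first.
  by move=> z; rewrite lee_fin mulr_ge0.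
rewrite /fubini_F /=.
rewrite (eq_integral (fun x => (f x)%:E * \int[m2]_y (g y)%:E)%E); last first.
  move=> x _; under eq_integral do rewrite EFinM.
  apply: (@ge0_integralZl _ _ _ m2 _ _ (EFin \o g)) => //.
  - exact/measurable_EFinP.
  - by move=> y _; rewrite lee_fin.
  - by rewrite lee_fin.
have -> : (\int[m1]_x ((f x)%:E * \int[m2]_y (g y)%:E)
    = \int[m1]_x (f x)%:E * \int[m2]_y (g y)%:E)%E.
  apply: (@ge0_integralZr _ _ _ m1 _ _ (EFin \o f)) => //.
  - exact/measurable_EFinP.
  - by move=> x _; rewrite lee_fin.
  - by apply: integral_ge0 => y _; rewrite lee_fin.
apply: lte_mul_pinfty.
+ by apply: integral_ge0 => x _; rewrite lee_fin.
+ exact: integrable_fin_num.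
+ by rewrite ltey_eq integrable_fin_num.
Qed.

(** By symmetry the integral is twice that over x >= 0, where the integrand is 1/c times the
    exponential density of rate c, of total mass 1. *)
Lemma integrable_expR_norm (R : realType) (c : R) : 0 < c ->
  (@lebesgue_measure R).-integrable setT (fun x => (expR (- c * `|x|))%:E).
Proof.
move=> c0.
have cf : continuous (fun x : R => expR (- c * `|x|)).
  move=> x; apply: continuous_comp; last exact: continuous_expR.
  by apply: continuousM; [exact: cst_continuous|exact: norm_continuous].
apply/integrableP; split.
  by apply/measurable_EFinP; exact: continuous_measurable_fun.
under eq_integral do rewrite abse_EFin (ger0_norm (expR_ge0 _)).
rewrite (@ge0_symfun_integralT R (fun x => expR (- c * `|x|)))//; last first.
  by move=> x /=; rewrite normrN.
apply: lte_mul_pinfty => //.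
have mp : measurable_fun [set: R] (exponential_pdf c).
  by apply: measurable_exponential_pdf; exact: ltW.
have e0 x := exponential_pdf_ge0 (ltW c0) x.
apply: (@le_lt_trans _ _ (\int[lebesgue_measure]_x
    (c^-1%:E * (exponential_pdf c x)%:E))%E); last first.
  have -> : (\int[lebesgue_measure]_x (c^-1%:E * (exponential_pdf c x)%:E)
      = c^-1%:E * \int[lebesgue_measure]_x (exponential_pdf c x)%:E)%E.
    apply: ge0_integralZl => //.
    - exact/measurable_EFinP.
    - by move=> x _; rewrite lee_fin.
    - by rewrite lee_fin invr_ge0 ltW.
  by rewrite integral_exponential_pdf// mule1 ltry.
have mI : measurable [set x : R | 0 <= x] by rewrite -set_itvcy.
rewrite integral_mkcond; apply: ge0_le_integral => //.
- by move=> x _; apply: erestrict_ge0 => y _; rewrite lee_fin expR_ge0.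
- apply/(measurable_restrictT _ mI); apply: measurable_funTS.
  apply/measurable_EFinP; exact: continuous_measurable_fun.
- by apply: measurable_funeM; exact/measurable_EFinP.
- move=> x _; rewrite patchE; case: ifPn => [|_].
    rewrite inE/= => x0; rewrite exponential_pdfE// ger0_norm//.
    by rewrite -EFinM lee_fin mulrA mulVf ?mul1r// gt_eqF.
  by apply: mule_ge0; rewrite lee_fin// invr_ge0 ltW.
Qed.

(** * Effective potential *)

Section EffectivePotential.
Context {R : realType}.
Implicit Types e l x s : R.

Lemma lapse_gt0 x : 2 < x -> 0 < 1 - 2 / x.
Proof. by move=> x2; rewrite subr_gt0 ltr_pdivrMr ?mul1r//; lra. Qed.

Lemma lapse_le1 x : 2 < x -> 1 - 2 / x <= 1.
Proof. by move=> x2; rewrite gerBl divr_ge0//; lra. Qed.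

Lemma Ueff_ge0 l x : 2 < x -> 0 <= Ueff l x.
Proof.
move=> x2; rewrite /Ueff mulr_ge0//; first exact/ltW/lapse_gt0.
by apply: addr_ge0 => //; rewrite divr_ge0 ?sqr_ge0.
Qed.

(** The increment is written as a multiple of [Ueff l x] so that it can be bounded below where the
    potential exceeds 1 and x stays bounded. *)
Lemma Ueff_sub l l' x : 2 < x ->
  Ueff l' x - Ueff l x = Ueff l x * ((l' ^+ 2 - l ^+ 2) / (x ^+ 2 + l ^+ 2)).
Proof.
move=> x2; rewrite /Ueff; field.
have : 0 < x ^+ 2 + l ^+ 2 by rewrite ltr_wpDr ?sqr_ge0// exprn_gt0//; lra.
by move=> /gt_eqF->; rewrite gt_eqF//; lra.
Qed.

(** The coefficient (1 - 2/x)/x^2 of l^2 lies in [0, 1] for x > 2, so the estimate is uniform in x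
    and survives the supremum. *)
Lemma Ueff_lip l l' x : 2 < x ->
  Ueff l' x <= Ueff l x + `|l' ^+ 2 - l ^+ 2|.
Proof.
move=> x2.
have -> : Ueff l' x = Ueff l x + ((1 - 2 / x) / x ^+ 2) * (l' ^+ 2 - l ^+ 2).
  by rewrite /Ueff; field; rewrite gt_eqF//; lra.
rewrite lerD2l (le_trans (ler_norm _))// normrM ler_piMl// ger0_norm.
  rewrite ler_pdivrMr; last by rewrite exprn_gt0//; lra.
  rewrite mul1r (le_trans (lapse_le1 x2))//; nra.
by rewrite divr_ge0 ?sqr_ge0// ltW// lapse_gt0.
Qed.

Lemma Ueff_le l l' x : 2 < x -> l ^+ 2 <= l' ^+ 2 -> Ueff l x <= Ueff l' x.
Proof.
move=> x2 ll'; rewrite -subr_ge0 Ueff_sub// mulr_ge0 ?Ueff_ge0//.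
by rewrite divr_ge0 ?subr_ge0// addr_ge0 ?sqr_ge0.
Qed.

Lemma Ueff_le_asymptotic l x : 2 < x -> Ueff l x <= 1 + l ^+ 2 / x ^+ 2.
Proof.
move=> x2; rewrite /Ueff ler_piMl ?lapse_le1//.
by apply: addr_ge0 => //; rewrite divr_ge0 ?sqr_ge0.
Qed.

Lemma Ueff_le_bound l x : 2 < x -> Ueff l x <= 1 + l ^+ 2.
Proof.
move=> x2; rewrite (le_trans (Ueff_le_asymptotic l x2))// lerD2l.
rewrite ler_pdivrMr; last by rewrite exprn_gt0//; lra.
by rewrite ler_peMr ?sqr_ge0//; nra.
Qed.

Lemma has_sup_Ueff l : has_sup [set Ueff l x | x in `]2, +oo[%classic].
Proof.
split; first by exists (Ueff l 3), 3 => //=; rewrite in_itv/= andbT; lra.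
exists (1 + l ^+ 2) => _ [x /= + <-]; rewrite in_itv/= andbT.
exact: Ueff_le_bound.
Qed.

Lemma Ueff_le_Umax l x : 2 < x -> Ueff l x <= Umax l.
Proof.
move=> x2; apply: ub_le_sup; first exact: (has_sup_Ueff l).2.
by exists x => //=; rewrite in_itv/= x2.
Qed.

Lemma Umax_le l y : (forall x, 2 < x -> Ueff l x <= y) -> Umax l <= y.
Proof.
move=> Uy; apply: ge_sup; first exact: (has_sup_Ueff l).1.
by move=> _ [x /= + <-]; rewrite in_itv/= andbT; exact: Uy.
Qed.

Lemma lt_Umax l y : y < Umax l -> exists2 x, 2 < x & y < Ueff l x.
Proof.
move=> /sup_gt; case; first exact: (has_sup_Ueff l).1.
by move=> _ [x /= + <-]; rewrite in_itv/= andbT => x2 yU; exists x.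
Qed.

Lemma Umax_le_sqr l l' : l ^+ 2 <= l' ^+ 2 -> Umax l <= Umax l'.
Proof.
move=> ll'; apply: Umax_le => x x2.
by rewrite (le_trans (Ueff_le x2 ll'))// Ueff_le_Umax.
Qed.

Lemma Umax_dist l l' : `|Umax l - Umax l'| <= `|l ^+ 2 - l' ^+ 2|.
Proof.
have H (k k' : R) : Umax k <= Umax k' + `|k ^+ 2 - k' ^+ 2|.
  apply: Umax_le => x x2; rewrite (le_trans (Ueff_lip k' k x2))// lerD2r.
  exact: Ueff_le_Umax.
by rewrite ler_distl lerBlDr H/= [X in _ + X]distrC H.
Qed.

Lemma continuous_Umax : continuous (@Umax R).
Proof.
move=> l; apply/cvgrPdist_le => eps eps0.
have : (fun k : R => k ^+ 2) k @[k --> l] --> l ^+ 2 by exact: exprn_continuous.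
move/cvgrPdist_le => /(_ _ eps0); apply: filterS => k.
exact/le_trans/Umax_dist.
Qed.

(** Since e > 1 while the potential is at most 1 + l^2/x^2, values close to e occur only at bounded
    radii, and there passing from l to l' raises the potential by a fixed amount. *)
Lemma Umax_lt e l l' : 1 < e -> 0 <= l -> l < l' -> Umax l = e -> e < Umax l'.
Proof.
move=> e1 l0 ll' Ue.
have ll2 : 0 < l' ^+ 2 - l ^+ 2 by nra.
have lp : 0 < l ^+ 2.
  rewrite exprn_gt0// lt_neqAle l0 andbT eq_sym; apply/eqP => l00.
  suff : Umax l <= 1 by rewrite Ue; lra.
  apply: Umax_le => x x2; rewrite (le_trans (Ueff_le_asymptotic l x2))//.
  by rewrite l00 expr0n/= mul0r addr0.
(* Where [Ueff l x > c], the asymptotic bound gives x^2 < l^2/(c - 1), hence x^2 + l^2 <= [D]; the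
   increment is then at least [dl]. *)
pose c := (1 + e) / 2.
have c1 : 0 < c - 1 by rewrite /c; lra.
pose D := l ^+ 2 / (c - 1) + l ^+ 2.
have D0 : 0 < D by rewrite addr_gt0// divr_gt0.
pose dl := (l' ^+ 2 - l ^+ 2) / D.
have dl0 : 0 < dl by rewrite divr_gt0.
have : Num.max c (e - dl) < Umax l by rewrite Ue gt_max /c; apply/andP; split; lra.
move=> /lt_Umax[x x2]; rewrite gt_max => /andP[cU eU].
apply: lt_le_trans (Ueff_le_Umax l' x2).
have x0 : 0 < x ^+ 2 by rewrite exprn_gt0//; lra.
have xD : x ^+ 2 + l ^+ 2 <= D.
  rewrite lerD2r ler_pdivlMr//.
  have := lt_le_trans cU (Ueff_le_asymptotic l x2).
  by rewrite -ltrBlDl ltr_pdivlMr// mulrC => /ltW.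
suff : dl <= Ueff l' x - Ueff l x by lra.
rewrite Ueff_sub// (@le_trans _ _ ((l' ^+ 2 - l ^+ 2) / (x ^+ 2 + l ^+ 2)))//.
  by rewrite /dl ler_pM2l// lef_pV2// posrE addr_gt0.
apply: ler_peMl; last by rewrite /c in cU; lra.
by apply: divr_ge0; apply: ltW => //; exact: addr_gt0.
Qed.

(** The intermediate value theorem for the continuous [Umax] on [0, 6e] provides a root, so the
    default value of [xget] does not occur. *)
Lemma lambda_c_spec e : 1 < e ->
  0 <= lambda_c e /\ Umax (lambda_c e) = e ^+ 2.
Proof.
move=> e1; rewrite /lambda_c; case: xgetP => [l -> //|/= nex].
have e0 : 0 <= 6 * e by lra.
have U0 : Umax 0 <= e ^+ 2.
  apply: Umax_le => x x2; rewrite (le_trans (Ueff_le_asymptotic 0 x2))//.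
  rewrite expr0n/= mul0r addr0; nra.
(* The endpoint 6e is chosen so that the potential at radius 3 is (1 + 4e^2)/3 >= e^2. *)
have U1 : e ^+ 2 <= Umax (6 * e).
  have : (2 < 3 :> R) by lra.
  move=> /(Ueff_le_Umax (6 * e)); apply: le_trans.
  have -> : Ueff (6 * e) 3 = 1 / 3 * (1 + 4 * e ^+ 2) by rewrite /Ueff; field.
  nra.
have := @IVT R (@Umax R) 0 (6 * e) (e ^+ 2) e0.
case.
- exact/continuous_subspaceT/continuous_Umax.
- by rewrite ge_min le_max U0 U1 orbT.
- by move=> c; rewrite in_itv/= => /andP[c0 _] Uc; have := nex c; case.
Qed.

(** Monotonicity of [Umax], strict at the level e^2 > 1, trades the chosen root [lambda_c e] for a
    condition on a continuous function, which is visibly measurable. *)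
Lemma lt_lambda_c e l : 1 < e -> 0 <= l -> (l < lambda_c e) = (Umax l < e ^+ 2).
Proof.
move=> e1 l0; have [c0 Uc] := lambda_c_spec e1; have e21 : 1 < e ^+ 2 by nra.
apply/idP/idP => [lc|]; last first.
  by apply: contraTT; rewrite -!leNgt -Uc => cl; apply: Umax_le_sqr; nra.
rewrite -Uc lt_neqAle Umax_le_sqr ?andbT; last by nra.
by apply/eqP; rewrite Uc => Ul; have := Umax_lt e21 l0 lc Ul; rewrite Uc ltxx.
Qed.

Lemma lambda_c_lt e l : 1 < e -> 0 <= l -> (lambda_c e < l) = (e ^+ 2 < Umax l).
Proof.
move=> e1 l0; have [c0 Uc] := lambda_c_spec e1; have e21 : 1 < e ^+ 2 by nra.
apply/idP/idP => [cl|]; first exact: Umax_lt e21 c0 cl Uc.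
by apply: contraTT; rewrite -!leNgt -Uc => cl; apply: Umax_le_sqr; nra.
Qed.

(* e^2 - Ueff l x = radial_cubic e l x / x^3 *)
Definition radial_cubic e l x : R :=
  (e ^+ 2 - 1) * x ^+ 3 + 2 * x ^+ 2 - l ^+ 2 * x + 2 * l ^+ 2.

(** The derivative of [radial_cubic e l] in x. *)
Definition radial_cubic' e l x : R :=
  3 * (e ^+ 2 - 1) * x ^+ 2 + 4 * x - l ^+ 2.

Lemma le_Ueff e l x : 2 < x -> (e ^+ 2 <= Ueff l x) = (radial_cubic e l x <= 0).
Proof.
move=> x2; have x3 : 0 < x ^+ 3 by rewrite exprn_gt0//; lra.
have -> : Ueff l x = e ^+ 2 - radial_cubic e l x / x ^+ 3.
  by rewrite /Ueff /radial_cubic; field; rewrite gt_eqF//; lra.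
by rewrite lerBrDl gerDr pmulr_lle0 ?invr_gt0.
Qed.

(** The gap between the cubic and its tangent at s is (x - s)^2 times a factor that is positive for
    e > 1 and x, s > 0. *)
Lemma radial_cubic_convex e l x s : 1 < e -> 0 < x -> 0 < s ->
  radial_cubic e l s + radial_cubic' e l s * (x - s) <= radial_cubic e l x.
Proof.
move=> e1 x0 s0; rewrite -subr_ge0.
rewrite (_ : _ - _ = (x - s) ^+ 2 * ((e ^+ 2 - 1) * (x + 2 * s) + 2)); last first.
  by rewrite /radial_cubic /radial_cubic'; ring.
by rewrite mulr_ge0 ?sqr_ge0// addr_ge0// mulr_ge0//; [nra|lra].
Qed.

(* By convexity of the cubic, right of its largest root means positive value and slope. *)
Lemma turning_lt e l s : 1 < e -> lambda_c e < l -> 2 < s ->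
  (turning e l < s) = (0 < radial_cubic e l s) && (0 < radial_cubic' e l s).
Proof.
move=> e1 cl s2.
have l0 : 0 <= l by have [+ _] := lambda_c_spec e1; lra.
have [x0 x02 /ltW Ux0] : exists2 x, 2 < x & e ^+ 2 < Ueff l x.
  by apply: lt_Umax; rewrite -lambda_c_lt.
have qx0 : radial_cubic e l x0 <= 0 by rewrite -le_Ueff.
have tangent x : 2 < x ->
    radial_cubic e l s + radial_cubic' e l s * (x - s) <= radial_cubic e l x.
  by move=> x2; apply: radial_cubic_convex => //; lra.
pose S := [set x : R | 2 < x /\ e ^+ 2 <= Ueff l x].
have Sx0 : S x0 by [].
have Sub : has_ubound S.
  (* For x > 2 + l^2 the term 2 x^2 outweighs l^2 x, so the cubic is positive. *)
  exists (2 + l ^+ 2) => x [x2]; rewrite le_Ueff// => qx.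
  rewrite leNgt; apply/negP => lx.
  suff : 0 < radial_cubic e l x by lra.
  rewrite /radial_cubic; have : 0 <= (e ^+ 2 - 1) * x ^+ 3.
    by rewrite mulr_ge0// ?exprn_ge0//; [nra|lra].
  have : 0 <= l ^+ 2 by rewrite sqr_ge0.
  by nra.
apply/idP/andP => [ts|[qs q's]].
  have x0s : x0 < s by apply: le_lt_trans ts; exact: ub_le_sup.
  have qs : 0 < radial_cubic e l s.
    rewrite ltNge -le_Ueff//; apply/negP => Us; move: ts; rewrite ltNge.
    by move/negP; apply; exact: ub_le_sup.
  (* A nonpositive slope at s would make the tangent, hence the cubic, positive at [x0] < s. *)
  split => //; rewrite ltNge; apply/negP => q's.
  by have := tangent _ x02; nra.
(* The zero of the tangent at s (one Newton step) bounds the forbidden region from above and lies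
   strictly left of s. *)
apply: (@le_lt_trans _ _ (s - radial_cubic e l s / radial_cubic' e l s)).
  apply: ge_sup; first by exists x0.
  move=> x [x2]; rewrite le_Ueff// => qx.
  have := tangent _ x2 => tx.
  rewrite lerBrDr -lerBrDl ler_pdivrMr//; nra.
by rewrite gtrBl divr_gt0.
Qed.

End EffectivePotential.

(** The forbidden region contains some x > 2. If the turning point were at most 2, it would lie left
    of x and [turning_lt] would make the cubic positive there. *)
Lemma turning_gt2 (R : realType) (e l : R) :
  1 < e -> lambda_c e < l -> 2 < turning e l.
Proof.
move=> e1 cl; rewrite ltNge; apply/negP => t2.
have l0 : 0 <= l by have [+ _] := lambda_c_spec e1; lra.
have [x x2 /ltW] : exists2 x, 2 < x & e ^+ 2 < Ueff l x.
  by apply: lt_Umax; rewrite -lambda_c_lt.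
rewrite le_Ueff// leNgt => /negP; apply.
by have := turning_lt e1 cl x2; rewrite (le_lt_trans t2 x2) => /esym/andP[].
Qed.

(** * Measurability in momentum space *)

Lemma measurable_fun_fst d d1 d2 (T : measurableType d) (T1 : measurableType d1)
  (T2 : measurableType d2) (D : set T) (f : T -> T1 * T2) :
  measurable_fun D f -> measurable_fun D (fun x => (f x).1).
Proof. exact: measurableT_comp (@measurable_fst _ _ _ _). Qed.

Lemma measurable_fun_snd d d1 d2 (T : measurableType d) (T1 : measurableType d1)
  (T2 : measurableType d2) (D : set T) (f : T -> T1 * T2) :
  measurable_fun D f -> measurable_fun D (fun x => (f x).2).
Proof. exact: measurableT_comp (@measurable_snd _ _ _ _). Qed.

Ltac meas := repeat first
  [ assumption
  | exact: measurable_cst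
  | exact: measurable_id
  | apply: measurable_funM
  | apply: measurable_funD
  | apply: measurable_funN
  | apply: measurable_funV
  | apply: measurable_funX
  | apply: measurable_funsqrt
  | apply: measurable_fun_fst
  | apply: measurable_fun_snd ].

(** * Orbit integrals and angles *)

Section MeasurableOrbit.
Context {R : realType} {d} {T : measurableType d}.

(** The endpoint [a] enters only through a jointly measurable description [P] of the interval, valid
    over [D]. Since [k] and [P] are measurable on the whole product, the cut-off integrand is too,
    and Tonelli applies before restricting to [D]. *)
Lemma measurable_Rintegral_itv (D : set T) (a : T -> R) (b : R)
  (k : T * R -> R) (P : T * R -> bool) :
  measurable_fun setT k -> measurable_fun setT P ->
  (forall q s, D q -> (a q < s < b) = P (q, s)) ->
  measurable_fun D (fun q =>
    \int[lebesgue_measure]_(s in `]a q, b[%classic) k (q, s)).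
Proof.
move=> mk mP DP.
pose k' z := if P z then k z else 0.
have mk' : measurable_fun setT k' by apply: measurable_fun_ifT.
have /= mI := measurable_parametric_Rintegral (@lebesgue_measure R) mk'.
apply: eq_measurable_fun (measurable_funTS mI) => q /set_mem Dq.
rewrite [RHS]Rintegral_mkcond; apply: eq_Rintegral => s _.
by rewrite patchE /k' -(DP _ _ Dq) mem_setE in_itv.
Qed.

Lemma norm_divr_sqrt_le1 (a b : R) : -1 <= a / Num.sqrt (a ^+ 2 + b ^+ 2) <= 1.
Proof.
rewrite -ler_norml normrM.
(* For a = b = 0 the quotient is 0 because the inverse of 0 is 0. *)
have [->|s0] := eqVneq (Num.sqrt (a ^+ 2 + b ^+ 2)) 0.
  by rewrite invr0 normr0 mulr0.
have sp : 0 < Num.sqrt (a ^+ 2 + b ^+ 2) by rewrite lt_neqAle eq_sym s0 sqrtr_ge0.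
rewrite normfV (gtr0_norm sp) ler_pdivrMr// mul1r -sqrtr_sqr ler_wsqrtr//.
by rewrite lerDl sqr_ge0.
Qed.

Lemma angle2_itv (a b : R) : 0 <= angle2 a b <= 2 * pi.
Proof.
have ab := norm_divr_sqrt_le1 a b; rewrite /angle2.
have := acos_ge0 ab; have := acos_lepi ab; have := @pi_ge0 R.
by case: ifP => _; lra.
Qed.

Lemma measurable_angle2 (a b : T -> R) :
  measurable_fun setT a -> measurable_fun setT b ->
  measurable_fun setT (fun q => angle2 (a q) (b q)).
Proof.
move=> ma mb; rewrite /angle2.
have mc : measurable_fun setT (fun q => acos (a q / Num.sqrt (a q ^+ 2 + b q ^+ 2))).
  apply: measurable_fun_acos => //; first by move=> q _; exact: norm_divr_sqrt_le1.
  by meas.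
apply: measurable_fun_ifT => //; first by apply: measurable_fun_ler.
by meas.
Qed.

Variables (e l sg : T -> R).
Hypotheses (me : measurable_fun setT e) (ml : measurable_fun setT l)
  (msg : measurable_fun setT sg).

Let me1 : measurable_fun setT (fun z : T * R => e z.1).
Proof. exact: measurableT_comp me (@measurable_fst _ _ _ _). Qed.
Let ml1 : measurable_fun setT (fun z : T * R => l z.1).
Proof. exact: measurableT_comp ml (@measurable_fst _ _ _ _). Qed.
Let msg1 : measurable_fun setT (fun z : T * R => sg z.1).
Proof. exact: measurableT_comp msg (@measurable_fst _ _ _ _). Qed.
Let ms : measurable_fun setT (fun z : T * R => z.2).
Proof. exact: measurable_snd. Qed.

Lemma measurable_Umax : measurable_fun setT (fun q => Umax (l q)).
Proof.
apply: measurableT_comp ml; apply: continuous_measurable_fun.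
exact: continuous_Umax.
Qed.

(** Inverse and square root are total and measurable, so vanishing denominators and negative
    radicands are covered. *)
Lemma measurable_Gline_integrand : measurable_fun setT (fun z : T * R =>
  hG (e z.1) z.2 (pi_branch (e z.1) (l z.1) (sg z.1) z.2)).
Proof. by rewrite /hG /pi_branch /Ueff; meas. Qed.

Lemma measurable_Chiline_integrand : measurable_fun setT (fun z : T * R =>
  l z.1 / (z.2 ^+ 2 * (sg z.1 * Num.sqrt (e z.1 ^+ 2 - Ueff (l z.1) z.2)))).
Proof. by rewrite /Ueff; meas. Qed.

Lemma measurable_line_abs (xi : R) (k : T * R -> R) : measurable_fun setT k ->
  measurable_fun setT (fun q =>
    \int[lebesgue_measure]_(s in `]2, xi[%classic) k (q, s)).
Proof.
move=> mk; apply: (measurable_Rintegral_itv (P := fun z => (2 < z.2) && (z.2 < xi))) => //.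
by apply: measurable_and; apply: measurable_fun_ltr.
Qed.

(** The condition [turning (e q) (l q) < s] is replaced by the polynomial inequalities of
    [turning_lt]. *)
Lemma measurable_line_scat (xi : R) (k : T * R -> R) (D : set T) :
  (forall q, D q -> 1 < e q /\ lambda_c (e q) < l q) ->
  measurable_fun setT k ->
  measurable_fun D (fun q =>
    \int[lebesgue_measure]_(s in `]turning (e q) (l q), xi[%classic) k (q, s)).
Proof.
move=> De mk.
apply: (measurable_Rintegral_itv (P := fun z : T * R =>
  [&& 2 < z.2, 0 < radial_cubic (e z.1) (l z.1) z.2,
      0 < radial_cubic' (e z.1) (l z.1) z.2 & z.2 < xi])) => //.
  rewrite /radial_cubic /radial_cubic'.
  by do ![apply: measurable_and]; apply: measurable_fun_ltr; meas.
move=> q s /De[e1 cl] /=; rewrite andbA andbA; congr andb.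
(* For s <= 2 both sides are false, as the turning point lies beyond 2. *)
have [s2|s2] := ltP 2 s; first exact: turning_lt.
by apply/negbTE; rewrite -leNgt ltW// (le_lt_trans s2)// turning_gt2.
Qed.

End MeasurableOrbit.

(** * Measurability of the ranges of the initial data *)

Section DataDomains.
Context {R : realType}.
Local Notation R6 := (R * R * R * R * R * R)%type.

Lemma measurable_R_abs : measurable (@R_abs R).
Proof.
have -> : @R_abs R = [set y : R6 | [&& y.1.1.1.1.1 <= 0, 1 < y.1.1.2,
    `|y.1.2| < y.2, 0 <= y.2 & Umax y.2 < y.1.1.2 ^+ 2]].
  apply/seteqP; split => -[[[[[G q2] q3] e] lz] l] /=.
    by move=> [-> [e1 [-> [l0 +]]]]; rewrite lt_lambda_c// e1 l0.
  by case/and5P => ? ? ? ? ?; do !split => //; rewrite lt_lambda_c.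
apply: measurable_predset; do ![apply: measurable_and].
- by apply: measurable_fun_ler; meas.
- by apply: measurable_fun_ltr; meas.
- apply: measurable_fun_ltr; last by meas.
  by apply: measurableT_comp (@normr_measurable _ _) _; meas.
- by apply: measurable_fun_ler; meas.
- by apply: measurable_fun_ltr; [apply: measurable_Umax|]; meas.
Qed.

Lemma measurable_R_scat : measurable (@R_scat R).
Proof.
have -> : @R_scat R = [set y : R6 | [&& 1 < y.1.1.2,
    `|y.1.2| < y.2 & y.1.1.2 ^+ 2 < Umax y.2]].
  apply/seteqP; split => -[[[[[G q2] q3] e] lz] l] /=.
    move=> [e1 [lzl cl]]; rewrite -lambda_c_lt ?e1 ?lzl//.
    exact: le_trans (normr_ge0 _) (ltW lzl).
  case/and3P => e1 lzl Ul; do !split => //; rewrite lambda_c_lt//.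
  exact: le_trans (normr_ge0 _) (ltW lzl).
apply: measurable_predset; do ![apply: measurable_and].
- by apply: measurable_fun_ltr; meas.
- apply: measurable_fun_ltr; last by meas.
  by apply: measurableT_comp (@normr_measurable _ _) _; meas.
- by apply: measurable_fun_ltr; [|apply: measurable_Umax]; meas.
Qed.

End DataDomains.

(** * Momentum functions at a fixed observer *)

Section Momentum.
Context {R : realType}.
Variables (MH m r th ph : R).
Hypotheses (MH0 : 0 < MH) (m0 : 0 < m) (r2 : 2 * MH < r) (th0 : 0 < th < pi).
Local Notation T := (R * R * R)%type.
Implicit Types q : T.

Local Notation eps q := (epsP MH m r th q.1.1 q.1.2 q.2).
Local Notation lam q := (lamP MH m th q.1.2 q.2).
Local Notation lamz q := (lamzP MH m q.2).
Local Notation upt q := (p_up_t MH m r th q.1.1 q.1.2 q.2).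
Local Notation upr q := (p_up_r MH m r th q.1.1 q.1.2 q.2).
Local Notation sg q := (sigP MH m r th q.1.1 q.1.2 q.2).

Lemma measurable_ell2 : measurable_fun setT (fun q => ell2 th q.1.2 q.2).
Proof. by rewrite /ell2; meas. Qed.

Lemma measurable_p_up_t : measurable_fun setT (fun q => upt q).
Proof. by have := measurable_ell2; rewrite /p_up_t => ?; meas. Qed.

Lemma measurable_p_t : measurable_fun setT (fun q => p_t MH m r th q.1.1 q.1.2 q.2).
Proof. by have := measurable_p_up_t; rewrite /p_t => ?; meas. Qed.

Lemma measurable_eps : measurable_fun setT (fun q => eps q).
Proof. by have := measurable_p_t; rewrite /epsP => ?; meas. Qed.

Lemma measurable_lam : measurable_fun setT (fun q => lam q).
Proof. by have := measurable_ell2; rewrite /lamP => ?; meas. Qed.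

Lemma measurable_lamz : measurable_fun setT (fun q => lamz q).
Proof. by rewrite /lamzP; meas. Qed.

Lemma measurable_p_up_r : measurable_fun setT (fun q => upr q).
Proof. by have := measurable_p_t; rewrite /p_up_r => ?; meas. Qed.

Lemma measurable_sg : measurable_fun setT (fun q => sg q).
Proof.
have mr := measurable_p_up_r; rewrite /sigP.
by apply: measurable_fun_ifT => //; apply: measurable_fun_ler.
Qed.

Lemma measurable_pframe a :
  measurable_fun setT (fun q => pframe MH m a r th q.1.1 q.1.2 q.2).
Proof.
have mt := measurable_p_t; rewrite /pframe.
by case: a => [|[|[|a]]]; meas.
Qed.

Lemma measurable_shell_weight :
  measurable_fun setT (fun q => shell_weight MH m r th q.1.1 q.1.2 q.2).
Proof.
by have := measurable_p_up_t; rewrite /shell_weight => ?; meas.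
Qed.

Lemma measurable_Q2 : measurable_fun setT (fun q => Q2 th ph q.1.2 q.2).
Proof. by apply: measurable_angle2; rewrite /Lx /Ly; meas. Qed.

Lemma measurable_arg_lat : measurable_fun setT (fun q => arg_lat th ph q.1.2 q.2).
Proof.
have := measurable_ell2 => ?.
by apply: measurable_angle2; rewrite /Lx /Ly /Lz; meas.
Qed.

Local Notation Aabs := [set q : T | absorbed MH m r th q.1.1 q.1.2 q.2].
Local Notation Ascat := [set q : T | scattered MH m r th q.1.1 q.1.2 q.2].

Lemma lamP_ge0 q : 0 <= lam q.
Proof. by rewrite divr_ge0 ?sqrtr_ge0// mulr_ge0// ltW. Qed.

Lemma measurable_absorbed : measurable Aabs.
Proof.
have me := measurable_eps; have ml := measurable_lam; have mr := measurable_p_up_r.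
have -> : Aabs = [set q | [&& 1 < eps q, Umax (lam q) < eps q ^+ 2 & upr q < 0]].
  apply/seteqP; split => q; rewrite /= /absorbed.
    move=> [e1 [lc pr]]; apply/and3P; split => //.
    by rewrite -lt_lambda_c// lamP_ge0.
  case/and3P => e1 Ue pr; split=> //; split=> //.
  by rewrite lt_lambda_c// lamP_ge0.
apply: measurable_predset; do ![apply: measurable_and]; apply: measurable_fun_ltr; meas.
exact: measurable_Umax.
Qed.

Lemma observer_radius : 2 < r / MH.
Proof. by rewrite ltr_pdivlMr. Qed.

Lemma measurable_scattered : measurable Ascat.
Proof.
have me := measurable_eps; have ml := measurable_lam.
have -> : Ascat = [set q | [&& 1 < eps q, eps q ^+ 2 < Umax (lam q),
    0 < radial_cubic (eps q) (lam q) (r / MH) &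
    0 < radial_cubic' (eps q) (lam q) (r / MH)]].
  have xi2 := observer_radius.
  apply/seteqP; split => q; rewrite /= /scattered.
    move=> [e1 [cl]]; rewrite turning_lt// => /andP[c0 c0']; apply/and4P.
    by split => //; rewrite -lambda_c_lt// lamP_ge0.
  case/and4P => e1; rewrite -lambda_c_lt ?lamP_ge0// => cl c0 c0'.
  split=> //; split => //; rewrite turning_lt//; exact/andP.
apply: measurable_predset; do ![apply: measurable_and]; apply: measurable_fun_ltr;
  rewrite /radial_cubic /radial_cubic'; meas.
exact: measurable_Umax.
Qed.

Lemma measurable_Gp_absorbed :
  measurable_fun Aabs (fun q => Gp MH m r th q.1.1 q.1.2 q.2).
Proof.
have mG := measurable_line_abs (r / MH) (measurable_Gline_integrand
  measurable_eps measurable_lam measurable_sg).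
apply: eq_measurable_fun (measurable_funTS mG) => q /set_mem Aq.
by rewrite /Gp /Gline /xiref asboolT.
Qed.

Lemma measurable_Q3_absorbed :
  measurable_fun Aabs (fun q => Q3 MH m r th ph q.1.1 q.1.2 q.2).
Proof.
have mC := measurable_line_abs (r / MH) (measurable_Chiline_integrand
  measurable_eps measurable_lam measurable_sg).
apply: measurable_funB.
  by apply: measurable_funTS; exact: measurable_arg_lat.
apply: eq_measurable_fun (measurable_funTS mC) => q /set_mem Aq.
by rewrite /Chiline /xiref asboolT.
Qed.

Lemma scattered_not_absorbed q : Ascat q -> ~ Aabs q.
Proof. by move=> [_ [cl _]] [_ [lc _]]; have := lt_trans cl lc; rewrite ltxx. Qed.

Lemma measurable_Gp_scattered :
  measurable_fun Ascat (fun q => Gp MH m r th q.1.1 q.1.2 q.2).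
Proof.
have De q : Ascat q -> 1 < eps q /\ lambda_c (eps q) < lam q by move=> [? []].
have := measurable_line_scat measurable_eps measurable_lam (r / MH) De
  (measurable_Gline_integrand measurable_eps measurable_lam measurable_sg).
apply: eq_measurable_fun => q /set_mem Aq.
by rewrite /Gp /Gline /xiref asboolF//; exact: scattered_not_absorbed.
Qed.

Lemma measurable_Q3_scattered :
  measurable_fun Ascat (fun q => Q3 MH m r th ph q.1.1 q.1.2 q.2).
Proof.
have De q : Ascat q -> 1 < eps q /\ lambda_c (eps q) < lam q by move=> [? []].
have mC := measurable_line_scat measurable_eps measurable_lam (r / MH) De
  (measurable_Chiline_integrand measurable_eps measurable_lam measurable_sg).
apply: measurable_funB.
  by apply: measurable_funTS; exact: measurable_arg_lat.
apply: eq_measurable_fun mC => q /set_mem Aq.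
by rewrite /Chiline /xiref asboolF//; exact: scattered_not_absorbed.
Qed.

End Momentum.

(** * Bounds on the mass shell *)

Section GlineSign.
Context {R : realType}.

(** With w the square root of e^2 - U, the ingoing branch has denominator -w and numerator (e -
    (2/s) w)/(1 - 2/s), which is nonnegative because w <= e. *)
Lemma hG_ingoing_le0 (e l s : R) : 0 <= e -> 2 < s -> hG e s (pi_branch e l (-1) s) <= 0.
Proof.
move=> e0 s2; have U0 := Ueff_ge0 l s2.
set w := Num.sqrt (e ^+ 2 - Ueff l s).
have w0 : 0 <= w by exact: sqrtr_ge0.
have we : w <= e.
  by rewrite -[leRHS]ger0_norm// -sqrtr_sqr ler_wsqrtr// gerBl.
have s0 : s != 0 by rewrite gt_eqF//; lra.
have s2' : s - 2 != 0 by rewrite gt_eqF//; lra.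
have -> : hG e s (pi_branch e l (-1) s) =
    - ((e - 2 / s * w) / (1 - 2 / s)) / w.
  (* If w = 0, both sides are 0 by the convention on the inverse of 0. *)
  have [w00|w00] := eqVneq w 0.
    rewrite /hG /pi_branch -/w w00 mulr0 addr0 invr0 mulr0.
    rewrite (_ : (1 - 2 / s) * _ - _ = 0) ?invr0 ?mulr0//; field.
    by rewrite s0.
  rewrite /hG /pi_branch -/w; field; rewrite s0 s2' w00 /=.
  rewrite (_ : _ - 2 * e = - (w * s)); last by ring.
  by rewrite oppr_eq0 mulf_neq0.
rewrite mulNr oppr_le0 divr_ge0// divr_ge0 ?(ltW (lapse_gt0 s2))// subr_ge0.
apply: le_trans we; rewrite ler_piMl//.
by rewrite ler_pdivrMr ?mul1r; lra.
Qed.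

(** The sign survives divergence, since [fine] sends an infinite integral to 0. *)
Lemma Rintegral_le0 d (T : measurableType d) (mu : {measure set T -> \bar R})
  (D : set T) (f : T -> R) : (forall x, D x -> f x <= 0) ->
  \int[mu]_(x in D) f x <= 0.
Proof.
move=> f0; rewrite /Rintegral fine_le0//.
under eq_integral do rewrite -[f _]opprK EFinN.
rewrite integral_ge0N; last by move=> x Dx; rewrite lee_fin oppr_ge0 f0.
by rewrite oppe_le0; apply: integral_ge0 => x Dx; rewrite lee_fin oppr_ge0 f0.
Qed.

Lemma Gline_ingoing_le0 (e l xi : R) : 0 <= e -> Gline e l (-1) 2 xi <= 0.
Proof.
move=> e0; apply: Rintegral_le0 => s /=; rewrite in_itv/= => /andP[s2 _].
exact: hG_ingoing_le0.
Qed.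

End GlineSign.

(** The shift n is chosen before h, so a single n serves the whole family of functions indexed by
    the time t. *)
Lemma periodic_reduce (R : realType) (p x : R) : 0 < p ->
  exists2 n : int, 0 <= x + n%:~R * p <= p &
  forall h : R -> R, (forall y, h (y + p) = h y) -> h x = h (x + n%:~R * p).
Proof.
move=> p0; exists (- Num.floor (x / p)).
  have := floor_itv (x / p).
  rewrite ler_pdivlMr// ltr_pdivrMr// intrD mulrDl mul1r => /andP[].
  by rewrite intrN mulNr; lra.
move=> h hp.
have hn (n : nat) y : h (y + n%:R * p) = h y.
  elim: n y => [|n IH] y; first by rewrite mul0r addr0.
  by rewrite -natr1 mulrDl mul1r addrA hp IH.
case: (- _) => n; first by rewrite hn.
by rewrite NegzE intrN -[in LHS](subrK (n.+1%:R * p) x) hn mulNr.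
Qed.

(** * Estimates by the contravariant component p^t *)

Section Bounds.
Context {R : realType}.
Variables (MH m r th : R).
Hypotheses (MH0 : 0 < MH) (m0 : 0 < m) (r2 : 2 * MH < r) (th0 : 0 < th < pi).
Local Notation T := (R * R * R)%type.
Implicit Types q : T.

Let r0 : 0 < r. Proof. by apply: lt_trans r2; rewrite mulr_gt0. Qed.
Let k01 : 0 < 2 * MH / r < 1.
Proof. by rewrite divr_gt0 ?mulr_gt0//= ltr_pdivrMr// mul1r. Qed.
Let sin0 : 0 < sin th. Proof. exact: sin_gt0_pi. Qed.

Local Notation eps q := (epsP MH m r th q.1.1 q.1.2 q.2).
Local Notation lam q := (lamP MH m th q.1.2 q.2).
Local Notation lamz q := (lamzP MH m q.2).
Local Notation upt q := (p_up_t MH m r th q.1.1 q.1.2 q.2).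
Local Notation Aabs := [set q : T | absorbed MH m r th q.1.1 q.1.2 q.2].
Local Notation Ascat := [set q : T | scattered MH m r th q.1.1 q.1.2 q.2].

Lemma sqr_div_sin_le_ell2 pth pph : (pph / sin th) ^+ 2 <= ell2 th pth pph.
Proof. by rewrite /ell2 expr_div_n lerDr sqr_ge0. Qed.

Lemma sqr_le_ell2 pth pph : pth ^+ 2 + pph ^+ 2 <= ell2 th pth pph.
Proof.
rewrite /ell2 lerD2l ler_pdivlMr ?exprn_gt0//; apply: ler_piMr.
  exact: sqr_ge0.
by rewrite exprn_ile1 ?sin_le1// ltW.
Qed.

Lemma ell2_ge0 pth pph : 0 <= ell2 th pth pph.
Proof. exact: le_trans (sqr_ge0 _) (sqr_div_sin_le_ell2 pth pph). Qed.

(** The factor 1 + 2 MH/r >= 1 only enlarges the radicand of p^t; each momentum component is bounded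
    by p^t in this way. *)
Lemma le_p_up_t (x : R) q :
  x ^+ 2 <= q.1.1 ^+ 2 + (ell2 th q.1.2 q.2 / r ^+ 2 + m ^+ 2) -> `|x| <= upt q.
Proof.
move=> xq; rewrite -sqrtr_sqr /p_up_t ler_wsqrtr// (le_trans xq)// lerD2l.
have /andP[k0 _] := k01.
apply: ler_peMl; last by rewrite lerDl ltW.
by rewrite addr_ge0 ?sqr_ge0// divr_ge0 ?ell2_ge0 ?sqr_ge0.
Qed.

Lemma mass_le_p_up_t q : m <= upt q.
Proof.
rewrite -[leLHS]gtr0_norm//; apply: le_p_up_t.
have := sqr_ge0 q.1.1.
have : 0 <= ell2 th q.1.2 q.2 / r ^+ 2 by rewrite divr_ge0 ?ell2_ge0 ?sqr_ge0.
by lra.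
Qed.

Lemma p_up_t_gt0 q : 0 < upt q.
Proof. exact: lt_le_trans (mass_le_p_up_t q). Qed.

Lemma norm_pr_le q : `|q.1.1| <= upt q.
Proof.
apply: le_p_up_t; rewrite lerDl.
by rewrite addr_ge0 ?sqr_ge0// divr_ge0 ?ell2_ge0 ?sqr_ge0.
Qed.

Lemma norm_angular_le (y : R) q : y ^+ 2 <= ell2 th q.1.2 q.2 ->
  `|y| / r <= upt q.
Proof.
move=> yl; rewrite -[X in _ / X](gtr0_norm r0) -normf_div; apply: le_p_up_t.
have : (y / r) ^+ 2 <= ell2 th q.1.2 q.2 / r ^+ 2.
  by rewrite expr_div_n ler_pM2r// invr_gt0 exprn_gt0.
by have := sqr_ge0 q.1.1; have := sqr_ge0 m; lra.
Qed.

Lemma norm_pth_le q : `|q.1.2| / r <= upt q.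
Proof.
apply: norm_angular_le; apply: le_trans (sqr_le_ell2 _ _).
by rewrite lerDl sqr_ge0.
Qed.

Lemma norm_pph_sin_le q : `|q.2 / sin th| / r <= upt q.
Proof. by apply: norm_angular_le; exact: sqr_div_sin_le_ell2. Qed.

Lemma norm_pph_le q : `|q.2| / r <= upt q.
Proof.
apply: norm_angular_le; apply: le_trans (sqr_le_ell2 _ _).
by rewrite lerDr sqr_ge0.
Qed.

Lemma norm_p_t_le q : `|p_t MH m r th q.1.1 q.1.2 q.2| <= upt q.
Proof.
have [/andP[k0 k1] P0 Pr] := And3 k01 (p_up_t_gt0 q) (norm_pr_le q).
move: Pr; rewrite /p_t !ler_norml => /andP[Pr1 Pr2].
have k1' : 0 < 1 + 2 * MH / r by lra.
by rewrite ler_pdivlMr// ler_pdivrMr//; apply/andP; split; nra.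
Qed.

Lemma norm_pframe_le (a : nat) q :
  `|pframe MH m a r th q.1.1 q.1.2 q.2| <= upt q / Num.sqrt (1 - 2 * MH / r).
Proof.
have [/andP[k0 k1] P0 Pr] := And3 k01 (p_up_t_gt0 q) (norm_pr_le q).
have Pt := norm_p_t_le q.
set N := 1 - 2 * MH / r.
have N0 : 0 < Num.sqrt N by rewrite sqrtr_gt0 subr_gt0.
have N1 : Num.sqrt N <= 1 by rewrite -sqrtr1 ler_wsqrtr// gerBl ltW.
(* The angular components carry no factor 1/sqrt N; since N < 1, inserting it only weakens the
   bound. *)
have big (y : R) : `|y| <= upt q -> `|y| <= upt q / Num.sqrt N.
  by move=> /le_trans; apply; rewrite ler_pdivlMr// ler_piMr// ltW.
case: a => [|[|[|a]]]; rewrite /pframe -/N.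
- by rewrite normf_div (gtr0_norm N0) ler_pM2r ?invr_gt0.
(* The weights 2 MH/r and N of p_t and p_r add up to 1. *)
- rewrite normf_div (gtr0_norm N0) ler_pM2r ?invr_gt0//.
  rewrite (le_trans (ler_normD _ _))// [X in X + _]normrM [X in _ + X]normrM.
  rewrite (gtr0_norm k0) (gtr0_norm (_ : 0 < N)) /N ?subr_gt0//; nra.
- by apply: big; rewrite normf_div (gtr0_norm r0); exact: norm_pth_le.
- apply: big; rewrite [r * _]mulrC invfM mulrA normf_div (gtr0_norm r0).
  exact: norm_pph_sin_le.
Qed.

(** As p_r <= p^t, one has p^t - (2 MH/r) p_r >= (1 - 2 MH/r) p^t, with a positive factor outside
    the horizon. *)
Lemma epsP_ge q :
  (1 - 2 * MH / r) / ((1 + 2 * MH / r) * m) * upt q <= eps q.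
Proof.
have [/andP[k0 k1] P0 Pr] := And3 k01 (p_up_t_gt0 q) (norm_pr_le q).
have k1' : 0 < 1 + 2 * MH / r by lra.
have := Pr; rewrite ler_norml => /andP[_ Pr2].
have -> : eps q = (upt q - (2 * MH / r) * q.1.1) / ((1 + 2 * MH / r) * m).
  by rewrite /epsP /p_t -[- (_ / _)]mulNr opprB invfM mulrA.
rewrite mulrAC ler_pM2r ?invr_gt0 ?mulr_gt0//; nra.
Qed.

(* the constants come from eps >= kappa p^t, x <= e^x and
   3 p^t >= |p_r| + |p_th| / r + |p_ph| / r *)
Lemma exp_bound (beta : R) : 0 < beta -> exists K c : R, [/\ 0 < K, 0 < c &
  forall q, upt q * expR (- (beta * eps q)) <=
    K * (expR (- c * `|q.1.1|) * expR (- c * `|q.1.2|) * expR (- c * `|q.2|))].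
Proof.
move=> b0; set kp := (1 - 2 * MH / r) / ((1 + 2 * MH / r) * m).
have /andP[k0 k1] := k01.
have kp0 : 0 < kp.
  by apply: divr_gt0; [rewrite subr_gt0|rewrite mulr_gt0// addr_gt0].
(* Half of the rate beta kappa absorbs the factor p^t through b p^t <= exp(b p^t); the other half
   gives the decay. *)
pose b := beta * kp / 2; have b'0 : 0 < b by rewrite /b divr_gt0// mulr_gt0.
pose c0 := Num.min 1 r^-1 / 3.
have c00 : 0 < c0 by rewrite /c0 divr_gt0// lt_min ltr01 invr_gt0.
exists b^-1, (b * c0); split; [by rewrite invr_gt0|exact: mulr_gt0|move=> q].
have P0 := p_up_t_gt0 q.
have c0P : c0 * (`|q.1.1| + `|q.1.2| + `|q.2|) <= upt q.
  have [Pr Pth Pph] := And3 (norm_pr_le q) (norm_pth_le q) (norm_pph_le q).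
  have c1 : 3 * c0 <= 1 by rewrite /c0 mulrC divfK// ge_min lexx.
  have c2 : 3 * c0 <= r^-1 by rewrite /c0 mulrC divfK// ge_min lexx orbT.
  have n1 := normr_ge0 q.1.1; have n2 := normr_ge0 q.1.2; have n3 := normr_ge0 q.2.
  have : 3 * c0 * `|q.1.1| <= upt q by nra.
  have : 3 * c0 * `|q.1.2| <= upt q.
    by apply: le_trans Pth; rewrite mulrC ler_wpM2l.
  have : 3 * c0 * `|q.2| <= upt q.
    by apply: le_trans Pph; rewrite mulrC ler_wpM2l.
  by lra.
rewrite -!expRD -ler_pdivrMl ?invr_gt0// invrK.
apply: (@le_trans _ _ (expR (b * upt q) * expR (- (beta * eps q)))).
  rewrite mulrA ler_wpM2r ?expR_ge0//.
  by rewrite (le_trans _ (expR_ge1Dx _))// lerDr.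
rewrite -expRD ler_expR.
have := ler_wpM2l (ltW b0) (epsP_ge q); rewrite -/kp.
have := ler_wpM2l (ltW b'0) c0P.
have -> : beta * (kp * upt q) = 2 * (b * upt q) by rewrite /b; field.
have -> : - (b * c0) * `|q.1.1| + - (b * c0) * `|q.1.2| + - (b * c0) * `|q.2|
    = - (b * (c0 * (`|q.1.1| + `|q.1.2| + `|q.2|))) by ring.
move: (b * upt q) (beta * eps q) (b * (c0 * _)) => x y z; lra.
Qed.

End Bounds.

(** * Passage to the limit *)

Lemma mom3_slice_null (R : realType) :
  @mom3 R [set q : R * R * R | q.1.2 = 0] = 0%E.
Proof.
have -> : [set q : R * R * R | q.1.2 = 0] = ([set: R] `*` [set 0]) `*` [set: R].
  by apply/seteqP; split => [[[x y] z]|[[x y] z]] /=; [|case=> -[]].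
rewrite /mom3 product_measure1E//=; last exact: measurableX.
rewrite product_measure1E//.
by rewrite (_ : _ [set 0] = 0%E) ?mule0 ?mul0e//; exact: lebesgue_measure_set1.
Qed.

(* Outside R_abs and R_scat the data may be non-measurable; on the equator momenta
   with p_theta = 0 lead there (|lambda_z| = lambda), so this null set is removed
   before integrating. *)
Lemma measurable_slice (R : realType) : measurable [set q : R * R * R | q.1.2 = 0].
Proof.
have -> : [set q : R * R * R | q.1.2 = 0] = [set q | q.1.2 == 0].
  by apply/seteqP; split => q /= /eqP.
apply: measurable_predset; apply: measurable_fun_eqr; last exact: measurable_cst.
exact/measurable_fun_snd/measurable_fun_fst.
Qed.

(* The library attaches its sigma-finite structure on products only to products of
   subprobabilities, hence this alias of the product measure. *)
Section SigmaFiniteProduct.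
Local Open Scope ereal_scope.
Context d1 d2 (T1 : measurableType d1) (T2 : measurableType d2) (R : realType).
Variables (m1 : {sigma_finite_measure set T1 -> \bar R})
  (m2 : {sigma_finite_measure set T2 -> \bar R}).

Definition tensor_measure : set (T1 * T2) -> \bar R := m1 \x m2.

HB.instance Definition _ := Measure.on tensor_measure.

(** Products of two increasing exhaustions: a pair with entries in stages i and j lies in stage
    max(i, j). *)
Lemma tensor_measure_sigma_finite : sigma_finite setT tensor_measure.
Proof.
have /sigma_finiteP[F [TF ndF Foo]] := sigma_finiteT m1.
have /sigma_finiteP[G [TG ndG Goo]] := sigma_finiteT m2.
exists (fun n => F n `*` G n).
  apply/seteqP; split => // -[x y] _.
  have [i _ Fx] : (\bigcup_i F i) x by rewrite -TF.
  have [j _ Gy] : (\bigcup_i G i) y by rewrite -TG.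
  exists (maxn i j) => //; split => /=.
    by move: x Fx; exact/subsetPset/ndF/leq_maxl.
  by move: y Gy; exact/subsetPset/ndG/leq_maxr.
move=> k; have [mF Fk] := Foo k; have [mG Gk] := Goo k.
split; first exact: measurableX.
by rewrite /tensor_measure product_measure1E// lte_mul_pinfty// ge0_fin_numE.
Qed.

HB.instance Definition _ := Measure_isSigmaFinite.Build _ _ _ tensor_measure
  tensor_measure_sigma_finite.

End SigmaFiniteProduct.

Lemma ge0_integrable_tensor3 d1 d2 d3 (T1 : measurableType d1)
  (T2 : measurableType d2) (T3 : measurableType d3) (R : realType)
  (m1 : {sigma_finite_measure set T1 -> \bar R})
  (m2 : {sigma_finite_measure set T2 -> \bar R})
  (m3 : {sigma_finite_measure set T3 -> \bar R})
  (f : T1 -> R) (g : T2 -> R) (h : T3 -> R) :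
  (forall x, 0 <= f x) -> (forall y, 0 <= g y) -> (forall z, 0 <= h z) ->
  m1.-integrable setT (EFin \o f) -> m2.-integrable setT (EFin \o g) ->
  m3.-integrable setT (EFin \o h) ->
  (m1 \x m2 \x m3)%E.-integrable setT (fun q => (f q.1.1 * g q.1.2 * h q.2)%:E).
Proof.
move=> f0 g0 h0 fi gi hi.
have fg := ge0_integrable_tensor f0 g0 fi gi.
exact: (@ge0_integrable_tensor _ _ _ _ R (tensor_measure m1 m2) m3 (fun z => f z.1 * g z.2) h
  (fun z => mulr_ge0 (f0 z.1) (g0 z.2)) h0 fg hi).
Qed.

Lemma integrable_exp_mom3 (R : realType) (c K : R) : 0 < c ->
  (@mom3 R).-integrable setT (fun q =>
    (K * (expR (- c * `|q.1.1|) * expR (- c * `|q.1.2|) * expR (- c * `|q.2|)))%:E).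
Proof.
move=> c0.
have e1 := integrable_expR_norm c0.
have h0 (x : R) : 0 <= expR (- c * `|x|) by exact: expR_ge0.
have e3 := @ge0_integrable_tensor3 _ _ _ _ _ _ R (@lebesgue_measure R)
  (@lebesgue_measure R) (@lebesgue_measure R) _ _ _ h0 h0 h0 e1 e1 e1.
under eq_fun do rewrite EFinM.
exact: integrableZl.
Qed.

(** Both maps are extended off [D] by their value at some [x0] in [D], and the extensions are paired
    on the whole space. *)
Lemma measurable_fun_pair_in d d1 d2 (T : measurableType d)
  (T1 : measurableType d1) (T2 : measurableType d2) (D : set T)
  (f : T -> T1) (g : T -> T2) : measurable D ->
  measurable_fun D f -> measurable_fun D g ->
  measurable_fun D (fun x => (f x, g x)).
Proof.
move=> mD mf mg; have [->|/set0P[x0 Dx0]] := eqVneq D set0.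
  exact: measurable_fun_set0.
have ext (T' : sigmaRingType _) (h : T -> T') : measurable_fun D h ->
    measurable_fun setT (fun x => if x \in D then h x else h x0).
  move=> mh; apply: (@measurable_fun_if _ _ _ _ h (cst (h x0))) => //.
  - by apply: (measurable_fun_bool true); rewrite setTI preimage_mem_true.
  - by rewrite setTI preimage_mem_true.
have mfg := measurable_fun_pair (ext _ _ _ mf) (ext _ _ _ mg).
apply: eq_measurable_fun (measurable_funTS mfg) => x xD /=.
by rewrite xD.
Qed.

(** * Limits of the distribution function and of its moments *)

Section Limit.
Context {R : realType}.
Variables (MH m r th ph : R).
Hypotheses (MH0 : 0 < MH) (m0 : 0 < m) (r2 : 2 * MH < r) (th0 : 0 < th < pi).
Local Notation T := (R * R * R)%type.
Implicit Types q : T.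

Local Notation eps q := (epsP MH m r th q.1.1 q.1.2 q.2).
Local Notation lam q := (lamP MH m th q.1.2 q.2).
Local Notation lamz q := (lamzP MH m q.2).
Local Notation upt q := (p_up_t MH m r th q.1.1 q.1.2 q.2).
Local Notation Aabs := [set q : T | absorbed MH m r th q.1.1 q.1.2 q.2].
Local Notation Ascat := [set q : T | scattered MH m r th q.1.1 q.1.2 q.2].
Local Notation gp q := (Gp MH m r th q.1.1 q.1.2 q.2).
Local Notation node q := (Q2 th ph q.1.2 q.2).
Local Notation lat q := (Q3 MH m r th ph q.1.1 q.1.2 q.2).
Local Notation slice := [set q : T | q.1.2 = 0].

(** Off the slice, ell^2 >= p_theta^2 + p_phi^2 > p_phi^2. *)
Lemma lamz_lt_lam q : ~ slice q -> `|lamz q| < lam q.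
Proof.
move=> /eqP pth0; have sth : 0 < sin th by exact: sin_gt0_pi.
have Mm : 0 < MH * m by exact: mulr_gt0.
rewrite /lamzP /lamP normf_div (gtr0_norm Mm) ltr_pM2r ?invr_gt0//.
rewrite -sqrtr_sqr ltr_sqrt; last first.
  rewrite (lt_le_trans _ (sqr_le_ell2 th0 _ _))// ltr_wpDr ?sqr_ge0//.
  by rewrite exprn_even_gt0.
rewrite (lt_le_trans _ (sqr_le_ell2 th0 _ _))// ltrDr.
by rewrite exprn_even_gt0.
Qed.

Lemma Gp_absorbed_le0 q : Aabs q -> gp q <= 0.
Proof.
move=> Aq; have [e1 [_ pr]] := Aq.
have sgq : sigP MH m r th q.1.1 q.1.2 q.2 = -1 by rewrite /sigP leNgt pr.
rewrite /Gp /xiref asboolT// sgq.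
by apply: Gline_ingoing_le0; apply: ltW; exact: lt_trans e1.
Qed.

(** The hypotheses on [Fabs] hold on [R_abs], which requires G <= 0; ingoing orbits have G <= 0, and
    subtracting t / MH >= 0 preserves this. *)
Lemma R_abs_orbit t q x y : 0 <= t -> ~ slice q -> Aabs q ->
  R_abs (gp q - t / MH, x, y, eps q, lamz q, lam q).
Proof.
move=> t0 Nq Aq; have [e1 [lc _]] := Aq; split.
  have := Gp_absorbed_le0 Aq; have : 0 <= t / MH by rewrite divr_ge0// ltW.
  by lra.
by do !split => //; [exact: lamz_lt_lam|exact: lamP_ge0].
Qed.

Lemma R_scat_orbit G q x y : ~ slice q -> Ascat q ->
  R_scat (G, x, y, eps q, lamz q, lam q).
Proof. by move=> Nq [e1 [cl _]]; split => //; split => //; exact: lamz_lt_lam. Qed.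

Variables (Fabs Fscat : R -> R -> R -> R -> R -> R -> R) (fm : R -> R).
Hypothesis mFabs : measurable_fun (@R_abs R) (uncurry6 Fabs).
Hypothesis mFscat : measurable_fun (@R_scat R) (uncurry6 Fscat).
Hypothesis pabs : forall G x y e lz l : R, R_abs (G, x, y, e, lz, l) ->
  Fabs G x (y + 2 * pi) e lz l = Fabs G x y e lz l.
Hypothesis pscat : forall G x y e lz l : R, R_scat (G, x, y, e, lz, l) ->
  Fscat G x (y + 2 * pi) e lz l = Fscat G x y e lz l.
Variables (alpha beta : R).
Hypotheses (alpha0 : 0 < alpha) (beta0 : 0 < beta).
Hypothesis babs : forall G x y e lz l : R, R_abs (G, x, y, e, lz, l) ->
  0 <= Fabs G x y e lz l <= alpha * expR (- (beta * e)).
Hypothesis bscat : forall G x y e lz l : R, R_scat (G, x, y, e, lz, l) ->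
  0 <= Fscat G x y e lz l <= alpha * expR (- (beta * e)).
Hypothesis labs : forall x y e lz l : R, 0 <= x <= 2 * pi -> 0 <= y <= 2 * pi ->
  1 < e -> `|lz| < l -> l < lambda_c e ->
  Fabs G x y e lz l @[G --> -oo] --> fm e.
Hypothesis lscat : forall e, 1 < e -> forall eta, 0 < eta -> exists G0 : R,
  forall G x y lz l : R, 0 <= x <= 2 * pi -> 0 <= y <= 2 * pi ->
    `|lz| < l -> lambda_c e < l -> G <= - G0 -> `|Fscat G x y e lz l - fm e| < eta.

Local Notation f t q := (f_accr MH m Fabs Fscat t r th ph q.1.1 q.1.2 q.2).
Local Notation fs q := (f_steady MH m fm 0 r th ph q.1.1 q.1.2 q.2).

Lemma f_accr_absorbed t q : Aabs q ->
  f t q = Fabs (gp q - t / MH) (node q) (lat q) (eps q) (lamz q) (lam q).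
Proof. by move=> Aq; rewrite /f_accr asboolT. Qed.

Lemma f_accr_scattered t q : Ascat q ->
  f t q = Fscat (gp q - t / MH) (node q) (lat q) (eps q) (lamz q) (lam q).
Proof.
move=> Aq; rewrite /f_accr asboolF ?asboolT//.
exact: (scattered_not_absorbed Aq).
Qed.

Lemma f_accr_other t q : ~ Aabs q -> ~ Ascat q -> f t q = 0.
Proof. by move=> NA NS; rewrite /f_accr !asboolF. Qed.

Lemma f_accr_bound t q : 0 <= t -> ~ slice q ->
  `|f t q| <= alpha * expR (- (beta * eps q)).
Proof.
move=> t0 Nq.
have [Aq|NA] := pselect (Aabs q).
  rewrite f_accr_absorbed//.
  by have /andP[F0 F1] := babs (R_abs_orbit (node q) (lat q) t0 Nq Aq); rewrite ger0_norm.
have [Sq|NS] := pselect (Ascat q).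
  rewrite f_accr_scattered//.
  by have /andP[F0 F1] := bscat (R_scat_orbit (gp q - t / MH) (node q) (lat q) Nq Sq);
    rewrite ger0_norm.
by rewrite f_accr_other// normr0 mulr_ge0 ?expR_ge0 ?ltW.
Qed.

Lemma f_accr_cvg q : ~ slice q -> f t q @[t --> +oo] --> fs q.
Proof.
move=> Nq; have lzl := lamz_lt_lam Nq.
have nodeI := angle2_itv (- Ly th ph q.1.2 q.2) (Lx th ph q.1.2 q.2).
have pi20 : 0 < 2 * pi :> R by rewrite mulr_gt0// pi_gt0.
(* The limits of the data are given for angles in [0, 2 pi]; Q^2 is already there, and Q^3 is
   shifted by a multiple of 2 pi independent of t. *)
have [n nI nP] := periodic_reduce (lat q) pi20.
have [Aq|NA] := pselect (Aabs q).
  have [e1 [lc _]] := Aq.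
  rewrite /f_steady asboolT; last by left.
  have := labs nodeI nI e1 lzl lc => cvgF.
  have cvgt : gp q - t / MH @[t --> +oo] --> -oo.
    apply/cvgrNyPle => A; near=> t.
    have : MH * (gp q - A) <= t.
      by near: t; apply: nbhs_pinfty_ge; exact: num_real.
    rewrite mulrC -ler_pdivlMr//; lra.
  apply: cvg_trans (cvg_comp _ _ cvgt cvgF); apply: near_eq_cvg.
  (* Periodicity of [Fabs] is available on [R_abs], hence once t >= 0. *)
  near=> t; have t0 : 0 <= t.
      by near: t; apply: nbhs_pinfty_ge; exact: num_real.
  rewrite /= f_accr_absorbed//; symmetry.
  apply: (nP (fun y => Fabs (gp q - t / MH) (node q) y (eps q) (lamz q) (lam q))) => y.
  exact/pabs/R_abs_orbit.
have [Sq|NS] := pselect (Ascat q).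
  have [e1 [cl _]] := Sq.
  rewrite /f_steady asboolT; last by right.
  apply/cvgrPdist_lt => eta eta0; have [G0 G0P] := lscat e1 eta0.
  near=> t; rewrite f_accr_scattered// distrC.
  rewrite (nP (fun y => Fscat (gp q - t / MH) (node q) y (eps q) (lamz q) (lam q))).
    apply: G0P => //.
    (* From this time on, G - t / MH <= - G0. *)
    have : MH * (gp q + G0) <= t.
      by near: t; apply: nbhs_pinfty_ge; exact: num_real.
    rewrite mulrC -ler_pdivlMr//; lra.
  by move=> y; exact/pscat/R_scat_orbit.
rewrite /f_steady asboolF; last by case.
apply: cvg_near_cst; near=> t; exact: f_accr_other.
Unshelve. all: by end_near. Qed.

(** Off the slice, momentum space splits into absorbed, scattered and remaining momenta. On the
    first two pieces f is the data composed with a measurable map [Phi] into [R_abs] or [R_scat]; on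
    the last it is 0. *)
Lemma measurable_f_accr t : 0 <= t -> measurable_fun (~` slice) (fun q => f t q).
Proof.
move=> t0.
have mN : measurable (~` slice) by apply: measurableC; exact: measurable_slice.
have mA := measurable_absorbed r th MH0 m0.
have mS := measurable_scattered th MH0 m0 r2.
pose Phi q := (gp q - t / MH, node q, lat q, eps q, lamz q, lam q).
have mPhi (D : set T) : measurable D -> measurable_fun D (fun q => gp q) ->
    measurable_fun D (fun q => lat q) -> measurable_fun D Phi.
  move=> mD mG m3; rewrite /Phi.
  have m2 := measurable_funTS (D := D) (measurable_Q2 th ph).
  have me := measurable_funTS (D := D) (measurable_eps MH m r th).
  have mlz := measurable_funTS (D := D) (measurable_lamz MH m).
  have ml := measurable_funTS (D := D) (measurable_lam MH m th).
  have mGt : measurable_fun D (fun q => gp q - t / MH).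
    by apply: measurable_funD => //; exact: measurable_cst.
  by do 5 (apply: measurable_fun_pair_in => //).
have mFA : measurable_fun (~` slice `&` Aabs) (fun q => f t q).
  apply: (@eq_measurable_fun _ _ _ _ _ (uncurry6 Fabs \o Phi)).
    by move=> q /set_mem[_ Aq]; rewrite f_accr_absorbed.
  apply: (measurable_comp measurable_R_abs _ mFabs).
    by move=> _ [q [Nq Aq] <-]; exact: R_abs_orbit.
  apply: mPhi; first exact: measurableI.
    by apply: (measurable_funS mA _ (@measurable_Gp_absorbed R MH m r th)) => q [].
  by apply: (measurable_funS mA _ (@measurable_Q3_absorbed R MH m r th ph)) => q [].
have mFS : measurable_fun (~` slice `&` Ascat) (fun q => f t q).
  apply: (@eq_measurable_fun _ _ _ _ _ (uncurry6 Fscat \o Phi)).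
    by move=> q /set_mem[_ Aq]; rewrite f_accr_scattered.
  apply: (measurable_comp measurable_R_scat _ mFscat).
    by move=> _ [q [Nq Aq] <-]; exact: R_scat_orbit.
  apply: mPhi; first exact: measurableI.
    by apply: (measurable_funS mS _ (@measurable_Gp_scattered R MH m r th)) => q [].
  by apply: (measurable_funS mS _ (@measurable_Q3_scattered R MH m r th ph)) => q [].
have mFO : measurable_fun (~` slice `&` ~` (Aabs `|` Ascat)) (fun q => f t q).
  apply: (@eq_measurable_fun _ _ _ _ _ (cst (0 : R))); last exact: measurable_cst.
  by move=> q /set_mem[_ /not_orP[NA NS]]; rewrite f_accr_other.
rewrite -(setIT (~` slice)) -(setUv (Aabs `|` Ascat)) setIUr setIUr.
have ? : measurable (~` slice `&` Aabs) by exact: measurableI.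
have ? : measurable (~` slice `&` Ascat) by exact: measurableI.
have ? : measurable (~` slice `&` ~` (Aabs `|` Ascat)).
  by apply: measurableI => //; apply: measurableC; exact: measurableU.
apply/measurable_funU => //; first exact: measurableU.
by split => //; exact/measurable_funU.
Qed.

(** Current and stress tensor are both moments whose weight [W] grows at most linearly in p^t, which
    is the growth that [exp_bound] dominates. *)
Lemma moment_cvg (W : T -> R) (C : R) : measurable_fun setT W ->
  (forall q, `|W q| <= C * upt q) ->
  \int[@mom3 R]_(q in setT) (W q * f t q) @[t --> +oo] -->
  \int[@mom3 R]_(q in setT) (W q * fs q).
Proof.
move=> mW WC.
have mN := @measurable_slice R; have N0 := mom3_slice_null R.
have E (g : T -> R) : \int[@mom3 R]_(q in setT) g q =
    \int[@mom3 R]_(q in ~` slice) g q by exact: Rintegral_setC_null.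
have [K [c [K0 c0 Kc]]] := exp_bound MH0 m0 r2 th0 beta0.
(* The sign of [C] is read off at zero momentum, where p^t > 0. *)
have C0 : 0 <= C.
  have P0 := p_up_t_gt0 th MH0 m0 r2 (0, 0, 0).
  by rewrite -(pmulr_lge0 _ P0) (le_trans _ (WC (0, 0, 0))).
rewrite E (_ : (fun t => _) =
    (fun t => \int[@mom3 R]_(q in ~` slice) (W q * f t q))); last first.
  by apply/funext => t; rewrite E.
pose h q := C * alpha * K * (expR (- c * `|q.1.1|) * expR (- c * `|q.1.2|) *
    expR (- c * `|q.2|)).
have hi : (@mom3 R).-integrable (~` slice) (EFin \o h).
  by apply: integrableS (integrable_exp_mom3 _ c0) => //; exact: measurableC mN.
apply: (Rintegral_cvg_pinfty _ _ _ hi).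
- exact: measurableC mN.
- move=> t t0.
  have mWf : measurable_fun (~` slice) (fun q => W q * f t q).
    by apply: measurable_funM; [exact: measurable_funTS|exact: measurable_f_accr].
  exact: mWf.
- by move=> q Nq; apply: cvgM; [exact: cvg_cst|exact: f_accr_cvg].
- move=> t q t0 Nq; rewrite normrM.
  apply: (@le_trans _ _ (C * upt q * (alpha * expR (- (beta * eps q))))).
    by apply: ler_pM => //; exact: f_accr_bound.
  rewrite mulrACA /h -[leRHS]mulrA; apply: ler_wpM2l; last exact: Kc.
  by rewrite mulr_ge0// ltW.
Qed.

Local Notation pf a q := (pframe MH m a r th q.1.1 q.1.2 q.2).
Local Notation sw q := (shell_weight MH m r th q.1.1 q.1.2 q.2).

(** The factor 1/p^t in the shell weight cancels the linear growth of a frame component. *)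
Lemma pframe_weight_bound (a : nat) : exists C, forall q, `|pf a q * sw q| <= C.
Proof.
exists (m / (r ^+ 2 * sin th) / Num.sqrt (1 - 2 * MH / r)) => q.
have P0 := p_up_t_gt0 th MH0 m0 r2 q.
have r0 : 0 < r by apply: lt_trans r2; rewrite mulr_gt0.
have rs : 0 < r ^+ 2 * sin th by rewrite mulr_gt0 ?sin_gt0_pi// exprn_gt0.
rewrite normrM.
apply: le_trans (ler_wpM2r (normr_ge0 _) (norm_pframe_le MH0 m0 r2 th0 a q)) _.
rewrite /shell_weight ger0_norm; last by rewrite ltW// divr_gt0// mulr_gt0.
set P := upt q in P0 *; set rs' := r ^+ 2 * sin th in rs *; set w := Num.sqrt _.
have w0 : 0 < w by rewrite sqrtr_gt0 subr_gt0 ltr_pdivrMr// mul1r.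
rewrite (_ : P / w * _ = m / rs' / w)//; field.
by rewrite !gt_eqF.
Qed.

Lemma Jframe_cvg (a : nat) :
  Jframe MH m (f_accr MH m Fabs Fscat) a t r th ph @[t --> +oo] -->
  Jframe MH m (f_steady MH m fm) a 0 r th ph.
Proof.
have [C WC] := pframe_weight_bound a.
have JE (g : T -> R) : \int[@mom3 R]_(q in setT) (pf a q * g q * sw q) =
    \int[@mom3 R]_(q in setT) (pf a q * sw q * g q).
  by apply: eq_Rintegral => q _; rewrite mulrAC.
rewrite /Jframe (JE (fun q => fs q)).
rewrite (_ : (fun t => _) =
    (fun t => \int[@mom3 R]_(q in setT) (pf a q * sw q * f t q))); last first.
  by apply/funext => t; rewrite (JE (fun q => f t q)).
(* The weight is bounded by [C], and p^t >= m turns this into (C/m) p^t. *)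
apply: (@moment_cvg (fun q => pf a q * sw q) (C / m)).
  apply: measurable_funM; first exact: measurable_pframe.
  exact: measurable_shell_weight.
move=> q; apply: le_trans (WC q) _.
have C0 : 0 <= C by exact: le_trans (WC q).
rewrite mulrAC ler_pdivlMr// ler_wpM2l//; exact: mass_le_p_up_t.
Qed.

Lemma Tframe_cvg (a b : nat) :
  Tframe MH m (f_accr MH m Fabs Fscat) a b t r th ph @[t --> +oo] -->
  Tframe MH m (f_steady MH m fm) a b 0 r th ph.
Proof.
have [C WC] := pframe_weight_bound b.
have TE (g : T -> R) : \int[@mom3 R]_(q in setT) (pf a q * pf b q * g q * sw q) =
    \int[@mom3 R]_(q in setT) (pf a q * pf b q * sw q * g q).
  by apply: eq_Rintegral => q _; rewrite mulrAC.
rewrite /Tframe (TE (fun q => fs q)).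
rewrite (_ : (fun t => _) =
    (fun t => \int[@mom3 R]_(q in setT) (pf a q * pf b q * sw q * f t q))); last first.
  by apply/funext => t; rewrite (TE (fun q => f t q)).
apply: (@moment_cvg (fun q => pf a q * pf b q * sw q)
    (C / Num.sqrt (1 - 2 * MH / r))).
  apply: measurable_funM; last exact: measurable_shell_weight.
  by apply: measurable_funM; exact: measurable_pframe.
(* One frame component grows like p^t; the other, paired with the shell weight, stays bounded. *)
move=> q; rewrite -mulrA normrM.
apply: le_trans (ler_pM (normr_ge0 _) (normr_ge0 _)
  (norm_pframe_le MH0 m0 r2 th0 a q) (WC q)) _.
by rewrite mulrC mulrA mulrAC.
Qed.

End Limit.

(** * Convergence of current and stress tensor along static observers *)

Theorem theorem3 (R : realType) (MH m : R)
  (Fabs Fscat : R -> R -> R -> R -> R -> R -> R) (fm fp : R -> R) :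
  0 < MH -> 0 < m ->
  (* (i) measurability *)
  measurable_fun (@R_abs R) (uncurry6 Fabs) ->
  measurable_fun (@R_scat R) (uncurry6 Fscat) ->
  (* (i) 2pi-periodicity in Q^2 and Q^3 *)
  (forall G q2 q3 e lz l, R_abs (G, q2, q3, e, lz, l) ->
     Fabs G (q2 + 2 * pi) q3 e lz l = Fabs G q2 q3 e lz l /\
     Fabs G q2 (q3 + 2 * pi) e lz l = Fabs G q2 q3 e lz l) ->
  (forall G q2 q3 e lz l, R_scat (G, q2, q3, e, lz, l) ->
     Fscat G (q2 + 2 * pi) q3 e lz l = Fscat G q2 q3 e lz l /\
     Fscat G q2 (q3 + 2 * pi) e lz l = Fscat G q2 q3 e lz l) ->
  (* (i) non-negativity and exponential bound *)
  (exists alpha beta : R, 0 < alpha /\ 0 < beta /\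
     (forall G q2 q3 e lz l, R_abs (G, q2, q3, e, lz, l) ->
        0 <= Fabs G q2 q3 e lz l <= alpha * expR (- (beta * e))) /\
     (forall G q2 q3 e lz l, R_scat (G, q2, q3, e, lz, l) ->
        0 <= Fscat G q2 q3 e lz l <= alpha * expR (- (beta * e)))) ->
  (* (ii) pointwise limit G -> -oo of the absorbed data *)
  (forall q2 q3 e lz l, 0 <= q2 <= 2 * pi -> 0 <= q3 <= 2 * pi -> 1 < e ->
     `|lz| < l -> l < lambda_c e ->
     Fabs G q2 q3 e lz l @[G --> -oo] --> fm e) ->
  (* (iii) uniform limits G -> +-oo of the scattered data *)
  (forall e, 1 < e -> forall eta, 0 < eta -> exists G0 : R,
     forall G q2 q3 lz l, 0 <= q2 <= 2 * pi -> 0 <= q3 <= 2 * pi ->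
       `|lz| < l -> lambda_c e < l ->
       (G0 <= G -> `|Fscat G q2 q3 e lz l - fp e| < eta) /\
       (G <= - G0 -> `|Fscat G q2 q3 e lz l - fm e| < eta)) ->
  (* conclusion: along every static observer *)
  forall r0 th0 ph0 : R, 2 * MH < r0 -> 0 < th0 < pi ->
  forall a b : 'I_4,
    Jframe MH m (f_accr MH m Fabs Fscat) a t r0 th0 ph0 @[t --> +oo] -->
      Jframe MH m (f_steady MH m fm) a 0 r0 th0 ph0 /\
    Tframe MH m (f_accr MH m Fabs Fscat) a b t r0 th0 ph0 @[t --> +oo] -->
      Tframe MH m (f_steady MH m fm) a b 0 r0 th0 ph0.
Proof.
move=> MH0 m0 mFabs mFscat pabs pscat [al [be [al0 [be0 [babs bscat]]]]] labs lscat.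
move=> r0 th0 ph0 r2 th0pi a b.
have pabs3 G x y e lz l : R_abs (G, x, y, e, lz, l) ->
    Fabs G x (y + 2 * pi) e lz l = Fabs G x y e lz l by case/pabs.
have pscat3 G x y e lz l : R_scat (G, x, y, e, lz, l) ->
    Fscat G x (y + 2 * pi) e lz l = Fscat G x y e lz l by case/pscat.
have lscat_m e : 1 < e -> forall eta, 0 < eta -> exists G0 : R,
    forall G x y lz l, 0 <= x <= 2 * pi -> 0 <= y <= 2 * pi ->
    `|lz| < l -> lambda_c e < l -> G <= - G0 -> `|Fscat G x y e lz l - fm e| < eta.
  move=> e1 eta eta0; have [G0 G0P] := lscat e e1 eta eta0.
  by exists G0 => G x y lz l xI yI lzl cl; have [] := G0P G x y lz l xI yI lzl cl.
split.
- exact: (@Jframe_cvg _ _ _ _ _ _ MH0 m0 r2 th0pi _ _ _ mFabs mFscat pabs3 pscat3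
    _ _ al0 be0 babs bscat labs lscat_m).
- exact: (@Tframe_cvg _ _ _ _ _ _ MH0 m0 r2 th0pi _ _ _ mFabs mFscat pabs3 pscat3
    _ _ al0 be0 babs bscat labs lscat_m).
Qed.
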